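(* Let $(\vartheta,\nabla)$ be a symmetric Poisson structure on a smooth manifold $M$. Then its characteristic distribution $\mathrm{im}\,\vartheta\subseteq TM$ is locally geodesically invariant for $\nabla$.
   Context: All manifolds and maps are smooth; a connection means an affine connection on $TM$, with induced connections denoted by the same symbol. $\mathfrak{X}^r_{\mathrm{sym}}(M)=\Gamma(\mathrm{Sym}^rTM)$, $\mathfrak{X}^\bullet_{\mathrm{sym}}(M)=\bigoplus_r\mathfrak{X}^r_{\mathrm{sym}}(M)$, with symmetric product $\odot$ normalized so that $X\odot Y=X\otimes Y+Y\otimes X$ for vector fields (in general $\mathcal{X}\odot\mathcal{Y}=\frac{(p+q)!}{p!q!}\mathrm{sym}(\mathcal{X}\otimes\mathcal{Y})$). For a connection $\nabla$, $[X,Y]_s:=\nabla_XY+\nabla_YX$ for vector fields, and the symmetric Schouten bracket is the unique $\mathbb{R}$-bilinear commutative map $[\cdot,\cdot]_s$ on $\mathfrak{X}^\bullet_{\mathrm{sym}}(M)$ extending it, with $[X,f]_s=Xf$, and such that for $\mathcal{X}\in\mathfrak{X}^r_{\mathrm{sym}}(M)$ the map $[\mathcal{X},\cdot]_s$ is a degree-$(r-1)$ derivation of $(\mathfrak{X}^\bullet_{\mathrm{sym}}(M),\odot)$. A symmetric Poisson structure on $M$ is a pair $(\vartheta,\nabla)$ of $\vartheta\in\mathfrak{X}^2_{\mathrm{sym}}(M)$ and a torsion-free connection $\nabla$ on $M$ with $[\vartheta,\vartheta]_s=0$. View $\vartheta$ as a map $T^*M\to TM$, $\beta(\vartheta(\alpha))=\vartheta(\alpha,\beta)$;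 its image $\mathrm{im}\,\vartheta$ (a distribution, possibly of non-constant rank) is the characteristic distribution. A distribution $\Delta\subseteq TM$ (an assignment of a linear subspace $\Delta_m\subseteq T_mM$ to each $m$) is locally geodesically invariant for $\nabla$ if for every $\nabla$-geodesic $\gamma:I\to M$, with $I$ an open interval, such that $\dot\gamma(t_0)\in\Delta_{\gamma(t_0)}$ for some $t_0\in I$, there is an open subinterval $I'\subseteq I$ containing $t_0$ such that $\dot\gamma(t)\in\Delta_{\gamma(t)}$ for every $t\in I'$. *)

(* Defs.v *)
From mathcomp Require Import all_boot all_order all_algebra all_fingroup.
From mathcomp Require Import all_classical all_reals all_analysis.
Import Order.TTheory GRing.Theory Num.Theory.
Import numFieldNormedType.Exports.

Set Implicit Arguments.
Unset Strict Implicit.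
Unset Printing Implicit Defensive.

Local Open Scope classical_set_scope.
Local Open Scope ring_scope.

(** * Smooth maps between finite-dimensional spaces *)

(* Only used for U open and V finite-dimensional, where this is the usual C^k. *)
Fixpoint Ck_on {R : realType} {V W : normedModType R} (k : nat)
    (U : set V) (f : V -> W) : Prop :=
  if k is k'.+1 then
    (forall x, U x -> differentiable f x) /\
    (forall v : V, Ck_on k' U (fun x => 'D_v f x))
  else forall x, U x -> {for x, continuous f}.

Definition smooth_on {R : realType} {V W : normedModType R}
    (U : set V) (f : V -> W) : Prop := forall k, Ck_on k U f.

(** * Smooth manifolds *)

(* A homeomorphism from an open subset [source] of T onto an open subset
   [target] of R^n; outside these sets the two maps take arbitrary values. *)
Record chart (R : realType) (n : nat) (T : topologicalType) := Chart {
  source : set T;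
  target : set 'rV[R]_n;
  to_coord :> T -> 'rV[R]_n;
  of_coord : 'rV[R]_n -> T;
  source_open : open source;
  target_open : open target;
  to_coord_target : forall m, source m -> target (to_coord m);
  of_coord_source : forall x, target x -> source (of_coord x);
  to_coordK : forall m, source m -> of_coord (to_coord m) = m;
  of_coordK : forall x, target x -> to_coord (of_coord x) = x;
  to_coord_continuous : forall m, source m -> {for m, continuous to_coord};
  of_coord_continuous : forall x, target x -> {for x, continuous of_coord} }.

(* The atlas need not be maximal.  [chart_at m] is a preferred chart around m;
   its only role is to provide a concrete model of the tangent space at m. *)
Record manifold (R : realType) (n : nat) := Manifold {
  points :> topologicalType;
  points_hausdorff : hausdorff_space points;
  points_second_countable : @second_countable points;
  atlas : set (chart R n points);
  atlas_compatible : forall c c', atlas c -> atlas c' ->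
    smooth_on (target c `&` of_coord c @^-1` source c')
              (fun x => c' (of_coord c x));
  chart_at : points -> chart R n points;
  chart_at_atlas : forall m, atlas (chart_at m);
  chart_at_source : forall m, source (chart_at m) m }.

(* T_mM is modelled on row vectors: v : 'rV_n stands for the tangent vector at m
   whose components in the chart [chart_at m] are v.  Likewise T*_mM is modelled
   on column vectors. *)

Definition pairing {R : realType} {n : nat} (alpha : 'cV[R]_n) (v : 'rV[R]_n) : R :=
  (v *m alpha) 0 0.

(* The differential of the chart c at m, as a matrix acting on row vectors:
   v : T_mM has components v *m dchart c m in the chart c. *)
Definition dchart {R : realType} {n : nat} {M : manifold R n}
    (c : chart R n M) (m : M) : 'M[R]_n :=
  jacobian (fun x => c (of_coord (chart_at m) x)) (chart_at m m).

Definition tangent_coord {R : realType} {n : nat} {M : manifold R n}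
    (c : chart R n M) (m : M) (v : 'rV[R]_n) : 'rV[R]_n := v *m dchart c m.

(* The covector at m whose components in the chart c are w. *)
Definition covector_of_coord {R : realType} {n : nat} {M : manifold R n}
    (c : chart R n M) (m : M) (w : 'cV[R]_n) : 'cV[R]_n := dchart c m *m w.

(* The i-th coordinate vector field of the chart c; meaningful on [source c]. *)
Definition coord_field {R : realType} {n : nat} {M : manifold R n}
    (c : chart R n M) (i : 'I_n) (m : M) : 'rV[R]_n :=
  delta_mx 0 i *m invmx (dchart c m).

(** * Functions and vector fields *)

Definition smooth_fun_on {R : realType} {n : nat} {M : manifold R n}
    (U : set M) (f : M -> R) : Prop :=
  forall c, atlas c ->
    smooth_on (target c `&` of_coord c @^-1` U) (fun x => f (of_coord c x)).

Definition smooth_vf_on {R : realType} {n : nat} {M : manifold R n}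
    (U : set M) (X : M -> 'rV[R]_n) : Prop :=
  forall c, atlas c ->
    smooth_on (target c `&` of_coord c @^-1` U)
      (fun x => tangent_coord c (of_coord c x) (X (of_coord c x))).

(* The derivative v f of f along v : T_mM. *)
Definition dirderiv {R : realType} {n : nat} {M : manifold R n}
    (m : M) (v : 'rV[R]_n) (f : M -> R) : R :=
  'D_v (fun x => f (of_coord (chart_at m) x)) (chart_at m m).

(** * Connections *)

(* [cov m v Y] is (nabla_v Y)(m), for v : T_mM and Y a vector field which is smooth
   on some open neighbourhood of m; the Leibniz rule makes it depend on the germ
   of Y at m only.  Thus [cov] is the operator on local sections
   X(U) * X(U) -> X(U), for all open U at once. *)
Record connection (R : realType) (n : nat) (M : manifold R n) := Connection {
  cov :> M -> 'rV[R]_n -> (M -> 'rV[R]_n) -> 'rV[R]_n;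
  cov_linear : forall (U : set M) m Y, open U -> U m -> smooth_vf_on U Y ->
    forall (a : R) v w, cov m (a *: v + w) Y = a *: cov m v Y + cov m w Y;
  cov_add : forall (U : set M) m Y Z, open U -> U m ->
    smooth_vf_on U Y -> smooth_vf_on U Z ->
    forall v, cov m v (fun p => Y p + Z p) = cov m v Y + cov m v Z;
  cov_leibniz : forall (U : set M) m f Y, open U -> U m ->
    smooth_fun_on U f -> smooth_vf_on U Y ->
    forall v, cov m v (fun p => f p *: Y p)
              = dirderiv m v f *: Y m + f m *: cov m v Y;
  cov_smooth : forall (U : set M) X Y, open U ->
    smooth_vf_on U X -> smooth_vf_on U Y ->
    smooth_vf_on U (fun m => cov m (X m) Y) }.

(* nabla_X Y - nabla_Y X = [X, Y], with the Lie bracket described by its action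
   on functions. *)
Definition torsion_free {R : realType} {n : nat} {M : manifold R n}
    (nabla : connection M) : Prop :=
  forall (U : set M) X Y f, open U ->
    smooth_vf_on U X -> smooth_vf_on U Y -> smooth_fun_on U f ->
    forall m, U m ->
      dirderiv m (nabla m (X m) Y - nabla m (Y m) X) f
      = dirderiv m (X m) (fun p => dirderiv p (Y p) f)
        - dirderiv m (Y m) (fun p => dirderiv p (X p) f).

(** * Geodesics *)

Definition smooth_curve {R : realType} {n : nat} {M : manifold R n}
    (I : set R) (gamma : R -> M) : Prop :=
  (forall t, I t -> {for t, continuous gamma}) /\
  (forall c, atlas c ->
     smooth_on (I `&` gamma @^-1` source c) (fun t => c (gamma t))).

Definition velocity {R : realType} {n : nat} {M : manifold R n}
    (gamma : R -> M) (t : R) : 'rV[R]_n :=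
  derive1 (fun s => chart_at (gamma t) (gamma s)) t.

(* The vector (Gamma^k_ij)_k of Christoffel symbols of nabla at m in the chart c. *)
Definition christoffel {R : realType} {n : nat} {M : manifold R n}
    (nabla : connection M) (c : chart R n M) (m : M) (i j : 'I_n) : 'rV[R]_n :=
  tangent_coord c m (nabla m (coord_field c i m) (coord_field c j)).

Definition geodesic {R : realType} {n : nat} {M : manifold R n}
    (nabla : connection M) (I : set R) (gamma : R -> M) : Prop :=
  smooth_curve I gamma /\
  forall t c, I t -> atlas c -> source c (gamma t) ->
    let x := fun s => c (gamma s) in
    derive1 (derive1 x) t
    + \sum_(i < n) \sum_(j < n)
        (derive1 x t 0 i * derive1 x t 0 j) *: christoffel nabla c (gamma t) i j
    = 0.

Definition locally_geodesically_invariant {R : realType} {n : nat}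
    {M : manifold R n} (nabla : connection M) (Delta : M -> set 'rV[R]_n) : Prop :=
  forall (I : set R) (gamma : R -> M) (t0 : R),
    open I -> is_interval I -> geodesic nabla I gamma ->
    I t0 -> Delta (gamma t0) (velocity gamma t0) ->
    exists I' : set R,
      [/\ open I', is_interval I', I' `<=` I, I' t0 &
          forall t, I' t -> Delta (gamma t) (velocity gamma t)].

(** * Symmetric multivector fields *)

(* An element X of the direct sum of the spaces of sections of Sym^r TM is encoded
   by X m [:: a_1; ...; a_r] := X_r(m)(a_1, ..., a_r), where X_r is its degree r
   component, seen as a field of symmetric r-linear forms on T*M. *)
Definition multifield {R : realType} {n : nat} (M : manifold R n) : Type :=
  M -> seq 'cV[R]_n -> R.

Definition is_sym_multivector {R : realType} {n : nat} {M : manifold R n}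
    (X : multifield M) : Prop :=
  [/\ forall m s s', perm_eq s s' -> X m s = X m s',
      forall m (a : R) alpha beta s,
        X m ((a *: alpha + beta) :: s) = a * X m (alpha :: s) + X m (beta :: s),
      (exists N, forall m s, (N < size s)%N -> X m s = 0) &
      forall c (s : seq 'cV[R]_n), atlas c ->
        smooth_on (target c)
          (fun x => X (of_coord c x)
                      [seq covector_of_coord c (of_coord c x) w | w <- s])].

Definition homogeneous {R : realType} {n : nat} {M : manifold R n}
    (r : nat) (X : multifield M) : Prop :=
  forall m s, size s != r -> X m s = 0.

Definition of_fun {R : realType} {n : nat} {M : manifold R n}
    (f : M -> R) : multifield M :=
  fun m s => if s is [::] then f m else 0.

Definition of_vf {R : realType} {n : nat} {M : manifold R n}
    (X : M -> 'rV[R]_n) : multifield M :=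
  fun m s => if s is [:: alpha] then pairing alpha (X m) else 0.

Definition perm_seq {R : realType} {n : nat} (s : seq 'cV[R]_n)
    (sigma : 'S_(size s)) : seq 'cV[R]_n :=
  [seq nth 0 s (sigma i) | i <- enum 'I_(size s)].

(* In bidegree (p, q) this is (p+q)!/(p! q!) sym(X (x) Y), where sym is the average
   over all permutations of the p + q arguments. *)
Definition symprod {R : realType} {n : nat} {M : manifold R n}
    (X Y : multifield M) : multifield M :=
  fun m s =>
    \sum_(p < (size s).+1)
      'C(size s, p)%:R *
      (((size s)`!)%:R^-1 *
       \sum_(sigma : 'S_(size s))
          X m (take p (perm_seq sigma)) * Y m (drop p (perm_seq sigma))).

(** * The symmetric Schouten bracket *)

(* These properties determine B on symmetric multivector fields.  The condition
   on degrees is degree r + s - 1, meaning zero when r = s = 0. *)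
Definition is_symmetric_schouten {R : realType} {n : nat} {M : manifold R n}
    (nabla : connection M)
    (B : multifield M -> multifield M -> multifield M) : Prop :=
  (forall X Y, is_sym_multivector X -> is_sym_multivector Y ->
     is_sym_multivector (B X Y)) /\
  (forall X Y, is_sym_multivector X -> is_sym_multivector Y ->
     B X Y =2 B Y X) /\
  (forall (a : R) X Y Z, is_sym_multivector X -> is_sym_multivector Y ->
     is_sym_multivector Z ->
     forall m s, B (fun p l => a * X p l + Y p l) Z m s
                 = a * B X Z m s + B Y Z m s) /\
  (forall X Y, smooth_vf_on setT X -> smooth_vf_on setT Y ->
     B (of_vf X) (of_vf Y)
     =2 of_vf (fun m => nabla m (X m) Y + nabla m (Y m) X)) /\
  (forall X f, smooth_vf_on setT X -> smooth_fun_on setT f ->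
     B (of_vf X) (of_fun f) =2 of_fun (fun m => dirderiv m (X m) f)) /\
  (forall r s X Y, is_sym_multivector X -> homogeneous r X ->
     is_sym_multivector Y -> homogeneous s Y ->
     forall m l, (size l).+1 != (r + s)%N -> B X Y m l = 0) /\
  (forall r X Y Z, is_sym_multivector X -> homogeneous r X ->
     is_sym_multivector Y -> is_sym_multivector Z ->
     forall m l, B X (symprod Y Z) m l
                 = symprod (B X Y) Z m l + symprod Y (B X Z) m l).

(** * Symmetric Poisson structures *)

(* The symmetric Schouten bracket of nabla exists and is unique, so that the
   quantifier over B merely names it. *)
Definition symmetric_poisson {R : realType} {n : nat} {M : manifold R n}
    (theta : multifield M) (nabla : connection M) : Prop :=
  [/\ is_sym_multivector theta, homogeneous 2 theta, torsion_free nabla &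
      exists2 B, is_symmetric_schouten nabla B &
                 forall m s, B theta theta m s = 0].

(* The image at m of theta : T*_mM -> T_mM, where beta (theta alpha) =
   theta (alpha, beta). *)
Definition characteristic_distribution {R : realType} {n : nat}
    {M : manifold R n} (theta : multifield M) (m : M) : set 'rV[R]_n :=
  [set v | exists alpha : 'cV[R]_n,
     forall beta : 'cV[R]_n, pairing beta v = theta m [:: alpha; beta]].

(* Main.v *)
Require Import Defs.
From mathcomp Require Import all_boot all_order all_algebra all_fingroup.
From mathcomp Require Import all_classical all_reals all_analysis.
From mathcomp Require Import ring lra.
Import Order.TTheory GRing.Theory Num.Theory.
Import numFieldNormedType.Exports.

(* In a chart, the condition [theta, theta]_s = 0 says that every covector a, with
   v = theta(a), satisfies the cubic identity
     v^l a_i a_j d_l theta^{ij} + 2 v^l v^k Gamma^m_{lk} a_m = 0.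
   Since the bracket is given on global fields only, it is evaluated at a point by
   cutting theta off in a way which is invisible to a derivation at that point.
   Let x be a geodesic with x'(t0) = theta(a0).  Solve along x the quadratic
   equation a'_l = 1/2 a_i a_j d_l theta^{ij} + (symmetrized Christoffel term in
   e_l and theta(a), applied to a), with a(t0) = a0.  By the polarized cubic
   identity, u = x' - theta(a) solves a homogeneous linear equation with
   u(t0) = 0; hence u vanishes and x' = theta(a) near t0. *)

Set Implicit Arguments.
Unset Strict Implicit.
Unset Printing Implicit Defensive.

Local Open Scope classical_set_scope.
Local Open Scope ring_scope.

(** * Ordinary differential equations *)

Section picard.
Context {R : realType}.

(** The rank of theta may jump along x, so linear algebra offers no continuous choice of a covector
    mapped to x', and im theta need not be a subbundle. This is why the covector comes from a
    differential equation, and the hypothesis is used for its value at t0 only. The equation is read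
    off the polarized identity. Write D for the partial derivatives of theta and v = theta(a).
    Halving the identity polarized at (a, a, b) gives D(v, a, b) + Gamma(v, v, b) = -(1/2
    D(theta(b), a, a) + Gamma(theta(b), v, a) + Gamma(v, theta(b), a)). Declaring the bracket on the
    right to be the pairing of a' with theta(b) makes theta(a) obey the geodesic equation as soon as
    x' = theta(a); otherwise the error is linear in u = x' - theta(a), with coefficients that are
    bounded near t0. The equation for a is quadratic, hence it is solved only near t0, which matches
    the local form of the conclusion. *)

Lemma rV_norm_leP n (x : 'rV[R]_n) (K : R) : 0 <= K ->
  reflect (forall i, `|x 0 i| <= K) (`|x| <= K).
Proof.
move=> K0; apply: (iffP idP) => [xK i|xK].
  apply: le_trans xK; rewrite [leRHS]/Num.Def.normr/= mx_normrE.
  exact: (le_bigmax _ (fun k : 'I_1 * 'I_n => `|x k.1 k.2|) (0, i)).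
rewrite /Num.Def.normr/= mx_normrE bigmax_le//= => -[j i] _ /=.
by rewrite (ord1 j).
Qed.

Lemma rV_coord_le_norm n (x : 'rV[R]_n) i : `|x 0 i| <= `|x|.
Proof. by move: i; apply/(rV_norm_leP _ (normr_ge0 x)). Qed.

Lemma is_derive_rV (V : normedModType R) n (f : V -> 'rV[R]_n) a v df :
  is_derive a v f df <-> forall i, is_derive a v (fun x => f x 0 i) (df 0 i).
Proof.
split=> [fdf i|fdf].
- have fa : derivable f a v by exact: ex_derive.
  have := derive_mx fa; rewrite (@derive_val _ _ _ _ _ _ _ fdf) => ->.
  rewrite mxE; apply: derivableP.
  by move/derivable_mxP : fa; apply.
- have fa : derivable f a v.
    by apply/derivable_mxP => i j; rewrite (ord1 i); exact: ex_derive.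
  apply: DeriveDef => //; rewrite derive_mx//.
  by apply/rowP => i; rewrite mxE; exact: derive_val.
Qed.

Lemma near_dist (t0 d t : R) : `|t - t0| < d ->
  \forall s \near t, `|s - t0| < d.
Proof.
move=> td; have : nbhs t (ball t0 d).
  apply: open_nbhs_nbhs; split; first exact: ball_open.
  by rewrite /ball/= distrC.
by apply: filterS => s; rewrite /ball/= distrC.
Qed.

Lemma primitive_near (f : R -> R) (t0 d : R) : 0 < d -> continuous f ->
  exists F : R -> R, forall t, `|t - t0| < d -> is_derive t 1 F (f t).
Proof.
move=> d0 cf.
exists (fun x => (\int[lebesgue_measure]_(t in [set` `[t0 - d, x]]) f t)%R).
move=> t; rewrite ltr_norml => /andP[t1 t2].
have [] := @continuous_FTC1_closed R f (t0 - d) t (t0 + d).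
- lra.
- apply: continuous_compact_integrable; first exact: segment_compact.
  exact: continuous_subspaceT.
- lra.
- exact: cf.
- by move=> dF <-; rewrite derive1E; exact: derivableP.
Qed.

(** The derivative is controlled inside the interval only; continuity on the closed interval carries
    the bound to the endpoints, where clipped times may land. *)
Lemma mean_value_bound (g dg : R -> R) (t0 d K : R) :
  (forall t, `|t - t0| < d -> is_derive t 1 g (dg t)) ->
  (forall t, `|t - t0| <= d -> {for t, continuous g}) ->
  (forall t, `|t - t0| < d -> `|dg t| <= K) ->
  forall t, `|t - t0| <= d -> `|g t - g t0| <= K * `|t - t0|.
Proof.
move=> gdg cg dgK t td.
have wlog_le a b : a <= b -> (forall s, a < s < b -> `|s - t0| < d) ->
    (forall s, a <= s <= b -> `|s - t0| <= d) -> `|g b - g a| <= K * `|b - a|.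
  rewrite le_eqVlt => /predU1P[->|ab] ho hc; first by rewrite !subrr normr0 mulr0.
  have [] := @MVT R g dg a b ab.
  - by move=> s; rewrite in_itv/= => sab; exact/gdg/ho.
  - apply: continuous_in_subspaceT => s /[!inE]/=; rewrite in_itv/= => sab.
    exact/cg/hc.
  move=> c; rewrite in_itv/= => cab ->; rewrite normrM ler_wpM2r//.
  exact/dgK/ho.
move: td; rewrite ler_norml => /andP[t1 t2].
have [tt0|t0t] := leP t0 t.
- apply: wlog_le => // s /andP[s1 s2].
    rewrite ltr_norml; apply/andP; split; lra.
  rewrite ler_norml; apply/andP; split; lra.
- rewrite distrC [in leRHS]distrC; apply: wlog_le; first exact: ltW.
    move=> s /andP[s1 s2]; rewrite ltr_norml; apply/andP; split; lra.
  move=> s /andP[s1 s2]; rewrite ler_norml; apply/andP; split; lra.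
Qed.

(** For [a <= b] this is the projection onto [[a, b]], a 1-Lipschitz map. It has two uses: freezing
    time outside a compact interval, and truncating a quadratic right-hand side into a globally
    Lipschitz one. *)
Definition clip (a b t : R) : R := Num.max a (Num.min b t).

Lemma clip_in a b t : a <= b -> a <= clip a b t <= b.
Proof. by move=> ab; rewrite /clip le_max lexx/= ge_max ab ge_min lexx. Qed.

Lemma clip_id a b t : a <= t <= b -> clip a b t = t.
Proof. by move=> /andP[a1 b1]; rewrite /clip (min_idPr b1) (max_idPr a1). Qed.

Lemma clip_continuous a b : continuous (clip a b).
Proof.
move=> t; apply: (@continuous_max _ _ (cst a) (Num.min b)).
  exact: cvg_cst.
apply: (@continuous_min _ _ (cst b) id).
  exact: cvg_cst.
exact: cvg_id.
Qed.

Lemma clip_lip a b s t : `|clip a b s - clip a b t| <= `|s - t|.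
Proof.
have := ler_norm (s - t); have := ler_norm (t - s); rewrite (distrC t s).
move=> st1 st2; rewrite /clip /Num.max /Num.min ler_norml.
by case: (ltP b s) => ?; case: (ltP b t) => ?;
  do 2 case: ltP => ?; apply/andP; split; lra.
Qed.


Lemma rV_continuous (T : topologicalType) n (f : T -> 'rV[R]_n) t :
  (forall i, {for t, continuous (fun s => f s 0 i)}) -> {for t, continuous f}.
Proof.
move=> cf; apply/cvgrPdist_le => /= e e0; near=> s.
apply/rV_norm_leP => [|i]; first exact: ltW.
rewrite !mxE; move: i; near: s; apply: filter_forall => i.
by have /cvgrPdist_le := cf i; apply.
Unshelve. all: by end_near. Qed.

Lemma rV_coord_continuous (T : topologicalType) n (f : T -> 'rV[R]_n) t i :
  {for t, continuous f} -> {for t, continuous (fun s => f s 0 i)}.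
Proof.
move=> cf; apply: (@continuous_comp _ _ _ f (fun M : 'rV[R]_n => M 0 i)) => //.
exact: coord_continuous.
Qed.

(** Every lower bound [v k - K / 2 ^+ k] lies below every upper bound [v j + K / 2 ^+ j], so the
    supremum of the lower bounds is a limit with an explicit rate. *)
Lemma geometric_squeeze (v : nat -> R) (K : R) :
  (forall k m, `|v (k + m)%N - v k| <= K / 2 ^+ k) ->
  exists l, forall k, `|l - v k| <= K / 2 ^+ k.
Proof.
move=> vK.
have vle j k : v k - K / 2 ^+ k <= v j + K / 2 ^+ j.
  have K0 i : 0 <= K / 2 ^+ i by exact: le_trans (normr_ge0 _) (vK i 0%N).
  have [kj|/ltnW jk] := leqP k j.
  - have := vK k (j - k)%N; rewrite subnKC// ler_norml => /andP[+ _].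
    have := K0 j; lra.
  - have := vK j (k - j)%N; rewrite subnKC// ler_norml => /andP[_].
    have := K0 k; lra.
pose A := [set v k - K / 2 ^+ k | k in [set: nat]].
have ubA j : ubound A (v j + K / 2 ^+ j) by move=> _ [k _ <-]; exact: vle.
exists (sup A) => k; rewrite ler_norml; apply/andP; split.
- rewrite lerBrDl; apply: ub_le_sup; first by exists (v 0%N + K / 2 ^+ 0).
  by exists k.
- rewrite lerBlDr addrC; apply: ge_sup => //.
  by exists (v 0%N - K / 2 ^+ 0), 0%N.
Qed.

Lemma geometric_le0 (a K : R) : (forall k, a <= K / 2 ^+ k) -> a <= 0.
Proof.
move=> aK; rewrite leNgt; apply/negP => a0.
have K0 : 0 < K by move: (aK 0%N); rewrite expr0 divr1; exact: lt_le_trans.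
have := archi_boundP (ltW (divr_gt0 K0 a0)).
set k := Num.bound _ => ltk.
have k2 : (k%:R : R) < 2 ^+ k by rewrite -natrX ltr_nat ltn_expl.
have := aK k; rewrite ler_pdivlMr ?exprn_gt0// leNgt => /negP; apply.
by rewrite mulrC -ltr_pdivrMr//; exact: lt_trans k2.
Qed.

(* Clipping the time makes the primitive continuous on the whole line, so that
   the Picard operator acts on all continuous maps from R to R^n. *)
Lemma primitive_rV n (f : R -> 'rV[R]_n) (t0 d : R) (x0 : 'rV[R]_n) :
  0 < d -> continuous f -> exists y : R -> 'rV[R]_n,
    [/\ continuous y, y t0 = x0,
        forall t, y t = y (clip (t0 - d) (t0 + d) t) &
        forall t, `|t - t0| < d -> is_derive t 1 y (f t)].
Proof.
move=> d0 cf.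
have d20 : 0 < 2 * d by lra.
have cfi i : continuous (fun t => f t 0 i).
  by move=> t; apply: rV_coord_continuous; exact: cf.
(* Primitives on twice the radius are differentiable, hence continuous, at the endpoints [t0 - d]
   and [t0 + d] that clipping produces. *)
have /choice[H HP] i := primitive_near t0 d20 (cfi i).
pose c := clip (t0 - d) (t0 + d).
have dd : t0 - d <= t0 + d by lra.
have ct0 : c t0 = t0 by apply: clip_id; apply/andP; split; lra.
have cc t : c (c t) = c t by apply: clip_id; exact: clip_in.
exists (fun t => \row_i (x0 0 i + (H i (c t) - H i t0))); split.
- move=> t; apply: rV_continuous => i.
  have -> : (fun s => (\row_j (x0 0 j + (H j (c s) - H j t0))) 0 i) =
      (fun u => x0 0 i + (H i u - H i t0)) \o c.
    by apply/funext => s; rewrite /= mxE.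
  apply: continuous_comp; first exact: clip_continuous.
  apply: cvgD; first exact: cvg_cst.
  apply: cvgB; last exact: cvg_cst.
  apply: differentiable_continuous; apply/derivable1_diffP.
  apply: (@ex_derive _ _ _ _ _ _ _ (HP i _ _)).
  have /andP[] := clip_in t dd; rewrite -/c => c1 c2.
  by rewrite ltr_norml; apply/andP; split; lra.
- by apply/rowP => i; rewrite mxE ct0 subrr addr0.
- by move=> t; apply/rowP => i; rewrite !mxE cc.
- move=> t td; move: (td); rewrite ltr_norml => /andP[t1 t2].
  apply/is_derive_rV => i.
  apply: (@near_eq_is_derive _ _ _ (fun s => x0 0 i + (H i s - H i t0))).
    near=> s; rewrite mxE /c clip_id//.
    have : `|s - t0| < d by near: s; exact: near_dist.
    by rewrite ltr_norml => /andP[s1 s2]; apply/andP; split; lra.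
  have HPt := HP i t.
  have {}HPt : is_derive t 1 (H i) (f t 0 i).
    by apply: HPt; rewrite ltr_norml; apply/andP; split; lra.
  rewrite -[f t 0 i]add0r -[X in _ + X]subr0.
  by apply: is_deriveD.
Unshelve. all: by end_near. Qed.

(** This is the contraction estimate of the Picard operator. Clipping brings any time within
    distance [d] of [t0], so the bound is uniform on the line. *)
Lemma primitive_rV_dist n (f g y z : R -> 'rV[R]_n) (t0 d K : R) :
  0 < d -> continuous y -> continuous z -> y t0 = z t0 ->
  (forall t, y t = y (clip (t0 - d) (t0 + d) t)) ->
  (forall t, z t = z (clip (t0 - d) (t0 + d) t)) ->
  (forall t, `|t - t0| < d -> is_derive t 1 y (f t)) ->
  (forall t, `|t - t0| < d -> is_derive t 1 z (g t)) ->
  (forall t, `|f t - g t| <= K) -> forall t, `|y t - z t| <= K * d.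
Proof.
move=> d0 cy cz yz0 yc zc dy dz fgK t.
have K0 : 0 <= K by exact: le_trans (normr_ge0 _) (fgK t0).
rewrite yc zc; move: (clip_in (a := t0 - d) (b := t0 + d) t).
set s := clip _ _ _ => /(_ ltac:(lra))/andP[s1 s2].
have sd : `|s - t0| <= d by rewrite ler_norml; apply/andP; split; lra.
apply/rV_norm_leP => [|i]; first by rewrite mulr_ge0// ltW.
have := @mean_value_bound (fun t => y t 0 i - z t 0 i)
  (fun t => f t 0 i - g t 0 i) t0 d K _ _ _ s sd.
rewrite yz0 subrr subr0 !mxE => h; apply: le_trans (h _ _ _) _.
- move=> u ud; apply: is_deriveB.
    by have /is_derive_rV := dy _ ud; apply.
  by have /is_derive_rV := dz _ ud; apply.
- move=> u _; apply: cvgB.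
    by apply: rV_coord_continuous; exact: cy.
  by apply: rV_coord_continuous; exact: cz.
- move=> u _; apply: le_trans (fgK u).
  by have := rV_coord_le_norm (f u - g u) i; rewrite !mxE.
- by rewrite ler_wpM2l.
Qed.

(** Since the Lipschitz bound holds for all [x], the iteration runs on all continuous maps from the
    line instead of an invariant ball, and [d] depends on [L] alone. *)
Lemma picard n (F : R -> 'rV[R]_n -> 'rV[R]_n) (L t0 : R) (x0 : 'rV[R]_n) :
  0 <= L ->
  (forall x : R -> 'rV[R]_n, continuous x -> continuous (fun t => F t (x t))) ->
  (forall t x y, `|F t x - F t y| <= L * `|x - y|) ->
  exists d, exists x : R -> 'rV[R]_n, [/\ 0 < d, continuous x, x t0 = x0 &
    forall t, `|t - t0| < d -> is_derive t 1 x (F t (x t))].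
Proof.
(* This [d] gives [L * d <= 1/2], so each iteration halves distances; [L + 1] keeps [d] positive
   when [L = 0]. *)
move=> L0 cF lipF; pose d := (2 * (L + 1))^-1.
have d0 : 0 < d by rewrite invr_gt0; lra.
have Ld : L * d <= 2^-1.
  rewrite /d invfM mulrCA ler_piMr ?invr_ge0//.
  by rewrite ler_pdivrMr; lra.
pose step (x y : R -> 'rV[R]_n) := continuous x -> [/\ continuous y, y t0 = x0,
    forall t, y t = y (clip (t0 - d) (t0 + d) t) &
    forall t, `|t - t0| < d -> is_derive t 1 y (F t (x t))].
(* Choice asks for a total operator, so [step] is an implication and a discontinuous [x] is sent to
   itself. *)
have /choice[Phi PhiP] (x : R -> 'rV[R]_n) : exists y, step x y.
  have [cx|ncx] := pselect (continuous x); last by exists x.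
  by have [y yP] := primitive_rV t0 x0 d0 (cF _ cx); exists y.
have contr (x y : R -> 'rV[R]_n) K : continuous x -> continuous y ->
    (forall t, `|x t - y t| <= K) -> forall t, `|Phi x t - Phi y t| <= K / 2.
  move=> cx cy xyK t.
  have [c1 e1 k1 D1] := PhiP x cx; have [c2 e2 k2 D2] := PhiP y cy.
  have K0 : 0 <= K by exact: le_trans (normr_ge0 _) (xyK t0).
  apply: (@le_trans _ _ (L * K * d)).
    apply: (primitive_rV_dist d0 c1 c2 _ k1 k2 D1 D2); first by rewrite e1.
    by move=> s; apply: le_trans (lipF _ _ _) _; rewrite ler_wpM2l.
  by rewrite mulrAC mulrC ler_wpM2l.
pose x_ k := iter k Phi (cst x0).
have cx_ k : continuous (x_ k).
  elim: k => [|k ih]; first by move=> t; exact: cvg_cst.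
  by have [] := PhiP _ ih.
have [C C0 CP] : exists2 C, 0 <= C & forall t, `|x_ 1%N t - x_ 0%N t| <= C.
  have [_ _ k1 _] := PhiP _ (cx_ 0%N).
  have [] := @EVT_max R (fun t => `|x_ 1%N t - x_ 0%N t|) (t0 - d) (t0 + d).
  - lra.
  - apply: continuous_subspaceT => t; apply: cvg_norm.
    by apply: cvgB; exact: cx_.
  move=> c _ cP; exists `|x_ 1%N c - x_ 0%N c| => // t.
  have -> : x_ 1%N t = x_ 1%N (clip (t0 - d) (t0 + d) t) by rewrite /x_ /= k1.
  apply: cP; rewrite in_itv/=; apply: clip_in; lra.
have stepC k t : `|x_ k.+1 t - x_ k t| <= C / 2 ^+ k.
  elim: k t => [|k ih] t; first by rewrite expr0 divr1.
  by rewrite exprSr invfM mulrA; exact: (contr (x_ k.+1) (x_ k) _ (cx_ _) (cx_ _) ih).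
have cauchyC k m t : `|x_ (k + m)%N t - x_ k t| <= 2 * C / 2 ^+ k.
  (* Subtracting the tail of the geometric series lets the induction on [m] go through: one more
     step costs [C / 2 ^+ (k + m)], exactly the change of the tail. *)
  suff : `|x_ (k + m)%N t - x_ k t| <= 2 * C / 2 ^+ k - 2 * C / 2 ^+ (k + m).
    move=> /le_trans; apply; rewrite gerBl.
    by apply: divr_ge0; [exact: mulr_ge0|exact: exprn_ge0].
  elim: m => [|m ih]; first by rewrite addn0 !subrr normr0.
  rewrite addnS -(subrKA (x_ (k + m)%N t)).
  apply: le_trans (ler_normD _ _) _.
  apply: le_trans (lerD (stepC _ _) ih) _.
  have -> : 2 * C / 2 ^+ (k + m).+1 = C / 2 ^+ (k + m).
    by rewrite exprS; field; rewrite expf_neq0.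
  lra.
have /choice[x xP] t : exists l : 'rV[R]_n,
    forall k, `|l - x_ k t| <= 2 * C / 2 ^+ k.
  have /choice[l lP] i : exists l, forall k, `|l - x_ k t 0 i| <= 2 * C / 2 ^+ k.
    apply: geometric_squeeze => k m; apply: le_trans (cauchyC k m t).
    by have := rV_coord_le_norm (x_ (k + m)%N t - x_ k t) i; rewrite !mxE.
  exists (\row_i l i) => k; apply/rV_norm_leP => [|i].
    by apply: divr_ge0; [exact: mulr_ge0|exact: exprn_ge0].
  by rewrite !mxE.
have cx : continuous x.
  move=> t; apply/cvgrPdist_le => /= e e0.
  have [k kP] : exists k, 2 * C / 2 ^+ k < e / 3.
    apply/not_existsP => h; have /geometric_le0 : forall k, e / 3 <= 2 * C / 2 ^+ k.
      by move=> k; rewrite leNgt; apply/negP.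
    by rewrite leNgt divr_gt0.
  near=> s.
  have -> : x t - x s = (x t - x_ k t) + (x_ k t - x_ k s) - (x s - x_ k s).
    by rewrite opprB !addrA !subrK.
  have -> : e = e / 3 + e / 3 + e / 3 by lra.
  apply: le_trans (ler_normB _ _) _; apply: lerD; last first.
    by apply: le_trans (xP _ _) _; exact: ltW.
  apply: le_trans (ler_normD _ _) _; apply: lerD.
    by apply: le_trans (xP _ _) _; exact: ltW.
  near: s; have /cvgrPdist_le := cx_ k t; apply; lra.
have [cy yt0 ky Dy] := PhiP _ cx.
(* Both sides are close to [x_ k.+1]: the left as a limit, the right because [Phi] halves the
   distance from [x] to [x_ k]. *)
have xE : x = Phi x.
  apply/funext => t; apply/eqP; rewrite -subr_eq0 -normr_le0.
  apply: (@geometric_le0 _ (2 * C)) => k.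
  rewrite -(subrKA (x_ k.+1 t)).
  apply: le_trans (ler_normD _ _) _.
  have -> : 2 * C / 2 ^+ k = 2 * C / 2 ^+ k.+1 + (2 * C / 2 ^+ k) / 2.
    by rewrite exprS; field; rewrite expf_neq0.
  apply: lerD => //; rewrite -opprB normrN.
  by apply: (contr x (x_ k) _ cx (cx_ k)) => s; exact: xP.
exists d, x; split => //; first by rewrite xE.
by move=> t td; rewrite {1}xE; exact: Dy.
Unshelve. all: by end_near. Qed.

End picard.

(** * Uniqueness for linear equations, local existence for quadratic ones *)

Section quadratic_ode.
Context {R : realType}.

(** On a radius [e] with [K * e <= 1/2], the maximum [m] of the norm of [u] satisfies
    [m <= K * m * e <= m / 2], hence is 0. Shrinking the interval takes the place of Gronwall's
    inequality. *)
Lemma linear_ode_unique n (u du : R -> 'rV[R]_n) (t0 d K : R) :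
  0 < d -> 0 <= K -> u t0 = 0 ->
  (forall t, `|t - t0| < d -> is_derive t 1 u (du t)) ->
  (forall t, `|t - t0| < d -> `|du t| <= K * `|u t|) ->
  exists2 e, 0 < e & forall t, `|t - t0| < e -> u t = 0.
Proof.
move=> d0 K0 u0 Du duK; pose e := Num.min (d / 2) (2 * (K + 1))^-1.
have e0 : 0 < e.
  rewrite lt_min; apply/andP; split; first lra.
  by rewrite invr_gt0; lra.
have ed : e < d by rewrite /e gt_min; apply/orP; left; lra.
have Ke : K * e <= 2^-1.
  apply: (@le_trans _ _ (K * (2 * (K + 1))^-1)).
    by rewrite ler_wpM2l// /e ge_min lexx orbT.
  rewrite invfM mulrCA ler_piMr ?invr_ge0//.
  by rewrite ler_pdivrMr; lra.
clearbody e; have cu t : `|t - t0| <= e -> {for t, continuous u}.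
  move=> te; apply: differentiable_continuous; apply/derivable1_diffP.
  by apply: (@ex_derive _ _ _ _ _ _ _ (Du _ _)); exact: le_lt_trans ed.
have inE t : t \in `[t0 - e, t0 + e] -> `|t - t0| <= e.
  rewrite in_itv/= => /andP[t1 t2]; rewrite ler_norml; apply/andP; split; lra.
have [] := @EVT_max R (fun t => `|u t|) (t0 - e) (t0 + e).
- lra.
- apply: continuous_in_subspaceT => t tI; apply: cvg_norm; apply: cu.
  by apply: inE; move: tI; rewrite inE.
move=> c ce uc; pose m := `|u c|.
have m0 : 0 <= m by exact: normr_ge0.
have um t : `|t - t0| <= e -> `|u t| <= m.
  move=> te; apply: uc; rewrite in_itv/=; move: te; rewrite ler_norml => /andP[].
  move=> t1 t2; apply/andP; split; lra.
have mm : m <= m / 2.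
  rewrite {1}/m; apply/rV_norm_leP => [|i]; first by rewrite divr_ge0.
  have := @mean_value_bound R (fun t => u t 0 i) (fun t => du t 0 i) t0 e (K * m).
  rewrite u0 mxE => /(_ _ _ _ c); rewrite subr0 => h.
  apply: le_trans (h _ _ _ (inE _ ce)) _.
  - move=> t te; have /is_derive_rV := Du t (lt_trans te ed); exact.
  - by move=> t te; apply: rV_coord_continuous; exact: cu.
  - move=> t te; apply: le_trans (rV_coord_le_norm _ _) _.
    apply: le_trans (duK _ (lt_trans te ed)) _.
    by rewrite ler_wpM2l// um// ltW.
  - apply: (@le_trans _ _ (K * m * e)).
      by rewrite ler_wpM2l// ?mulr_ge0//; exact: inE.
    by rewrite mulrAC mulrC ler_wpM2l.
clearbody m; have {mm} mE : m = 0 by apply/eqP; rewrite eq_le m0 andbT; lra.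
exists e => // t te; apply/eqP; rewrite -normr_le0 -mE um//; exact: ltW.
Qed.

Lemma sum_continuous (T : topologicalType) (I : Type) (r : seq I)
    (f : I -> T -> R) t : (forall i, {for t, continuous (f i)}) ->
  {for t, continuous (fun s => \sum_(i <- r) f i s)}.
Proof.
by move=> cf; apply: cvg_big => [|i _]; [exact: add_continuous|exact: cf].
Qed.

Lemma near_radius (P : R -> Prop) (t0 : R) : (\forall t \near t0, P t) ->
  exists2 d, 0 < d & forall t, `|t - t0| < d -> P t.
Proof.
move=> /nbhs_ballP[d /= d0 dP]; exists d => // t td.
by apply: dP; rewrite /ball/= distrC.
Qed.

(** A quadratic right-hand side is not globally Lipschitz in general. Its coordinates are clipped to
    within 1 of those of [a0], and time to the radius [e / 2], where compactness bounds the
    coefficients. The solution of the clipped equation stays within 1 of [a0] for a short time, and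
    there clipping does nothing. *)
Lemma quadratic_ode n (q : R -> 'I_n -> 'I_n -> 'I_n -> R) (t0 e : R)
    (a0 : 'rV[R]_n) : 0 < e ->
  (forall t l i j, `|t - t0| < e -> {for t, continuous (fun s => q s l i j)}) ->
  exists2 d, 0 < d & exists a : R -> 'rV[R]_n, a t0 = a0 /\
    forall t, `|t - t0| < d ->
      is_derive t 1 a (\row_l \sum_i \sum_j q t l i j * a t 0 i * a t 0 j).
Proof.
move=> e0 cq; pose c := clip (t0 - e / 2) (t0 + e / 2).
have cin t : `|c t - t0| < e.
  have /andP[] := @clip_in R (t0 - e / 2) (t0 + e / 2) t ltac:(lra).
  by rewrite -/c => c1 c2; rewrite ltr_norml; apply/andP; split; lra.
have cqc l i j : continuous (fun t => q (c t) l i j).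
  move=> t; apply: (@continuous_comp _ _ _ c (fun s => q s l i j)).
    exact: clip_continuous.
  exact: cq.
have cid t : `|t - t0| <= e / 2 -> c t = t.
  by rewrite ler_norml => /andP[t1 t2]; apply: clip_id; apply/andP; split; lra.
have /choice[Q QP] (l : 'I_n * 'I_n * 'I_n) :
    exists Q, forall t, `|q (c t) l.1.1 l.1.2 l.2| <= Q.
  have [] := @EVT_max R (fun t => `|q (c t) l.1.1 l.1.2 l.2|) (t0 - e / 2) (t0 + e / 2).
  - lra.
  - apply: continuous_subspaceT => t; apply: cvg_norm; exact: cqc.
  move=> s _ sP; exists `|q (c s) l.1.1 l.1.2 l.2| => t.
  have /andP[c1 c2] := @clip_in R (t0 - e / 2) (t0 + e / 2) t ltac:(lra).
  have := sP (c t); rewrite in_itv/= c1 c2 => /(_ isT).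
  by rewrite (cid (c t))// ler_norml; apply/andP; split; rewrite /c; lra.
pose r := `|a0| + 1.
pose k i := clip (a0 0 i - 1) (a0 0 i + 1).
have kr i x : `|k i x| <= r.
  have /andP[] := @clip_in R (a0 0 i - 1) (a0 0 i + 1) x ltac:(lra).
  rewrite -/(k i) /r => c1 c2; have := rV_coord_le_norm a0 i.
  by rewrite !ler_norml => /andP[h1 h2]; apply/andP; split; lra.
have r0 : 0 <= r by rewrite addr_ge0.
pose F t (x : 'rV[R]_n) : 'rV[R]_n :=
  \row_l \sum_i \sum_j q (c t) l i j * k i (x 0 i) * k j (x 0 j).
have Q0 l : 0 <= Q l by exact: le_trans (normr_ge0 _) (QP l t0).
(* On the clipped box a product of two coordinates changes by at most [2 * r] times the norm of
   [x - y]. Summing over [l] as well is wasteful but gives one constant for all rows. *)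
pose L := \sum_l \sum_i \sum_j Q (l, i, j) * (2 * r).
have L0 : 0 <= L.
  apply: sumr_ge0 => l _; apply: sumr_ge0 => i _; apply: sumr_ge0 => j _.
  by rewrite !mulr_ge0.
have [||d1 [a [d10 ca a_t0 Da]]] := @picard R n F L t0 a0 L0.
- move=> x cx t; apply: rV_continuous => l.
  rewrite (_ : (fun s => _) = (fun s => \sum_i \sum_j
      q (c s) l i j * k i (x s 0 i) * k j (x s 0 j))); last first.
    by apply/funext => s; rewrite mxE.
  have ckx i : {for t, continuous (fun s => k i (x s 0 i))}.
    apply: (@continuous_comp _ _ _ (fun s => x s 0 i) (k i)).
      by apply: rV_coord_continuous; exact: cx.
    exact: clip_continuous.
  apply: sum_continuous => i; apply: sum_continuous => j.
  by apply: cvgM; [apply: cvgM; [exact: cqc|exact: ckx]|exact: ckx].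
- move=> t x y; apply/rV_norm_leP => [|l]; first by rewrite mulr_ge0.
  rewrite !mxE -sumrB.
  have le1 i j : `|q (c t) l i j * k i (x 0 i) * k j (x 0 j) -
      q (c t) l i j * k i (y 0 i) * k j (y 0 j)| <= Q (l, i, j) * (2 * r) * `|x - y|.
    rewrite -!mulrA -mulrBr normrM; apply: ler_pM => //.
      exact: (QP (l, i, j) t).
    have -> : k i (x 0 i) * k j (x 0 j) - k i (y 0 i) * k j (y 0 j) =
        k i (x 0 i) * (k j (x 0 j) - k j (y 0 j)) +
        (k i (x 0 i) - k i (y 0 i)) * k j (y 0 j) by ring.
    have kl m : `|k m (x 0 m) - k m (y 0 m)| <= `|x - y|.
      apply: le_trans (clip_lip _ _ _ _) _.
      by have := rV_coord_le_norm (x - y) m; rewrite !mxE.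
    apply: le_trans (ler_normD _ _) _; rewrite !normrM.
    have -> : 2 * (r * `|x - y|) = r * `|x - y| + `|x - y| * r by ring.
    by apply: lerD; apply: ler_pM.
  apply: le_trans (ler_norm_sum _ _ _) _; rewrite /L mulr_suml.
  rewrite [leRHS](bigD1 l)//=.
  apply: (@le_trans _ _ ((\sum_i \sum_j Q (l, i, j) * (2 * r)) * `|x - y|)).
    rewrite mulr_suml; apply: ler_sum => i _; rewrite mulr_suml -sumrB.
    apply: le_trans (ler_norm_sum _ _ _) _; apply: ler_sum => j _; exact: le1.
  rewrite lerDl sumr_ge0// => m _; rewrite mulr_ge0//.
  by apply: sumr_ge0 => i _; apply: sumr_ge0 => j _; rewrite !mulr_ge0.
have [d2 d20 ad2] : exists2 d, 0 < d & forall t, `|t - t0| < d -> `|a0 - a t| < 1.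
  apply: near_radius; have /cvgrPdist_lt := ca t0.
  by rewrite a_t0; exact.
exists (Num.min (Num.min d1 (e / 2)) d2).
  by rewrite !lt_min d10 d20 andbT/=; lra.
exists a; split=> // t; rewrite !lt_min => /andP[/andP[td1 te] td2].
have := Da t td1; rewrite /F (cid t (ltW te)).
have kE i : k i (a t 0 i) = a t 0 i.
  have := le_lt_trans (rV_coord_le_norm _ i) (ad2 t td2).
  rewrite !mxE ltr_norml => /andP[h1 h2].
  by apply: clip_id; apply/andP; split; lra.
have -> // : (\row_l \sum_i \sum_j q t l i j * k i (a t 0 i) * k j (a t 0 j)) =
   (\row_l \sum_i \sum_j q t l i j * a t 0 i * a t 0 j).
apply/rowP => l; rewrite !mxE; apply: eq_bigr => i _; apply: eq_bigr => j _.
by rewrite !kE.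
Qed.

End quadratic_ode.

(** * Trilinear forms and polarization *)

Section form3.
Context {R : realType} {n : nat}.
Implicit Types (f : 'I_n -> 'I_n -> 'I_n -> R) (u v w : 'rV[R]_n).

(** It serves two kinds of coefficients. For the partial derivatives of theta, the first slot takes
    a vector and the other two take covectors; for the Christoffel symbols, the first two take
    vectors and the last a covector. *)
Definition form3 f u v w : R :=
  \sum_i \sum_j \sum_k f i j k * u 0 i * v 0 j * w 0 k.

Definition dot u v : R := \sum_k u 0 k * v 0 k.

Lemma form3Dl f u u' v w : form3 f (u + u') v w = form3 f u v w + form3 f u' v w.
Proof.
rewrite /form3 -big_split; apply: eq_bigr => i _; rewrite -big_split.
apply: eq_bigr => j _; rewrite -big_split; apply: eq_bigr => k _ /=.
by rewrite mxE; ring.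
Qed.

Lemma form3Dm f u v v' w : form3 f u (v + v') w = form3 f u v w + form3 f u v' w.
Proof.
rewrite /form3 -big_split; apply: eq_bigr => i _; rewrite -big_split.
apply: eq_bigr => j _; rewrite -big_split; apply: eq_bigr => k _ /=.
by rewrite mxE; ring.
Qed.

Lemma form3Dr f u v w w' : form3 f u v (w + w') = form3 f u v w + form3 f u v w'.
Proof.
rewrite /form3 -big_split; apply: eq_bigr => i _; rewrite -big_split.
apply: eq_bigr => j _; rewrite -big_split; apply: eq_bigr => k _ /=.
by rewrite mxE; ring.
Qed.

Lemma form3Nl f u v w : form3 f (- u) v w = - form3 f u v w.
Proof.
rewrite /form3 -sumrN; apply: eq_bigr => i _; rewrite -sumrN.
apply: eq_bigr => j _; rewrite -sumrN; apply: eq_bigr => k _.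
by rewrite mxE; ring.
Qed.

Lemma form3Nm f u v w : form3 f u (- v) w = - form3 f u v w.
Proof.
rewrite /form3 -sumrN; apply: eq_bigr => i _; rewrite -sumrN.
apply: eq_bigr => j _; rewrite -sumrN; apply: eq_bigr => k _.
by rewrite mxE; ring.
Qed.

Lemma form3Nr f u v w : form3 f u v (- w) = - form3 f u v w.
Proof.
rewrite /form3 -sumrN; apply: eq_bigr => i _; rewrite -sumrN.
apply: eq_bigr => j _; rewrite -sumrN; apply: eq_bigr => k _.
by rewrite mxE; ring.
Qed.

Lemma form3_symr f u v w : (forall i j k, f i j k = f i k j) ->
  form3 f u v w = form3 f u w v.
Proof.
move=> fC; apply: eq_bigr => i _; rewrite exchange_big; apply: eq_bigr => j _.
by apply: eq_bigr => k _; rewrite fC; ring.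
Qed.

(** Contracting the coefficients with [T] amounts to feeding [v *m T] to the middle slot; for a
    covector [v] this raises its index by theta. *)
Lemma form3_mulmxm f (T : 'M[R]_n) u v w :
  form3 (fun l i k => \sum_j f l j k * T i j) u v w = form3 f u (v *m T) w.
Proof.
apply: eq_bigr => l _; rewrite exchange_big [RHS]exchange_big.
apply: eq_bigr => k _ /=.
under eq_bigr do rewrite !mulr_suml.
rewrite exchange_big; apply: eq_bigr => j _ /=.
rewrite mxE mulr_sumr mulr_suml; apply: eq_bigr => i _; ring.
Qed.

Lemma form3_swap f u v w :
  form3 (fun i j k => f j i k) u v w = form3 f v u w.
Proof.
rewrite /form3 exchange_big; apply: eq_bigr => i _.
by apply: eq_bigr => j _; apply: eq_bigr => k _; ring.
Qed.

Lemma form3_lin (c : R) f g u v w :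
  form3 (fun i j k => c * f i j k + g i j k) u v w
  = c * form3 f u v w + form3 g u v w.
Proof.
rewrite /form3 mulr_sumr -big_split; apply: eq_bigr => i _.
rewrite mulr_sumr -big_split; apply: eq_bigr => j _.
by rewrite mulr_sumr -big_split; apply: eq_bigr => k _ /=; ring.
Qed.

Lemma form3_le f u v w :
  `|form3 f u v w| <= (\sum_i \sum_j \sum_k `|f i j k|) * `|u| * `|v| * `|w|.
Proof.
rewrite /form3 !mulr_suml.
apply: le_trans (ler_norm_sum _ _ _) _; apply: ler_sum => i _; rewrite !mulr_suml.
apply: le_trans (ler_norm_sum _ _ _) _; apply: ler_sum => j _; rewrite !mulr_suml.
apply: le_trans (ler_norm_sum _ _ _) _; apply: ler_sum => k _; rewrite !normrM.
by do 3 ?[apply: ler_pM => //; last exact: rV_coord_le_norm]; rewrite !mulr_ge0.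
Qed.

Lemma dot_delta u k : dot u (delta_mx 0 k) = u 0 k.
Proof.
rewrite /dot (bigD1 k)//= big1 ?mxE ?eqxx ?mulr1 ?addr0//= => i ik.
by rewrite mxE (negbTE ik) mulr0.
Qed.

Lemma norm_delta_le1 k : `|delta_mx 0 k : 'rV[R]_n| <= 1.
Proof.
apply/rV_norm_leP => // i; rewrite mxE.
by case: (_ && _); rewrite ?normr1 ?normr0.
Qed.

Lemma dotDl u v w : dot (u + v) w = dot u w + dot v w.
Proof. by rewrite -big_split; apply: eq_bigr => k _; rewrite mxE mulrDl. Qed.

Lemma dotNl u w : dot (- u) w = - dot u w.
Proof. by rewrite -sumrN; apply: eq_bigr => k _; rewrite mxE mulNr. Qed.

Lemma dot_mulmx u v (T : 'M[R]_n) : T^T = T -> dot (u *m T) v = dot u (v *m T).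
Proof.
move=> TT; rewrite /dot; under eq_bigr do rewrite mxE mulr_suml.
rewrite exchange_big; apply: eq_bigr => i _ /=; rewrite mxE mulr_sumr.
by apply: eq_bigr => j _; rewrite -{1}TT mxE; ring.
Qed.

Lemma dot_form3r f u v w :
  dot (\row_k \sum_i \sum_j f i j k * u 0 i * v 0 j) w = form3 f u v w.
Proof.
rewrite /dot /form3; under eq_bigr do rewrite mxE mulr_suml.
rewrite exchange_big; apply: eq_bigr => i _ /=.
under eq_bigr do rewrite mulr_suml.
by rewrite exchange_big.
Qed.

Lemma dot_form3l f u v w :
  dot (\row_l \sum_i \sum_j f l i j * v 0 i * w 0 j) u = form3 f u v w.
Proof.
apply: eq_bigr => i _; rewrite mxE mulr_suml; apply: eq_bigr => j _.
by rewrite mulr_suml; apply: eq_bigr => k _; ring.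
Qed.

(** The difference of the identities at [a + b] and [a - b] keeps the terms odd in [b]: twice the
    sum wanted and twice [C b b b], which is 0. As [C] is not assumed symmetric, the result is a sum
    over the positions of [b]. *)
Lemma cubic_polarization (C : 'rV[R]_n -> 'rV[R]_n -> 'rV[R]_n -> R) :
  (forall a b c d, C (a + b) c d = C a c d + C b c d) ->
  (forall a b c d, C a (b + c) d = C a b d + C a c d) ->
  (forall a b c d, C a b (c + d) = C a b c + C a b d) ->
  (forall a b c, C (- a) b c = - C a b c) ->
  (forall a b c, C a (- b) c = - C a b c) ->
  (forall a b c, C a b (- c) = - C a b c) ->
  (forall a, C a a a = 0) ->
  forall a b, C b a a + C a b a + C a a b = 0.
Proof.
move=> D1 D2 D3 N1 N2 N3 C0 a b.
have := C0 (a + b); have := C0 (a - b); have := C0 b; have := C0 a.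
rewrite !(D1, D2, D3, N1, N2, N3); lra.
Qed.

End form3.

(** * The covector along a geodesic *)

Section geodesic_ode.
Context {R : realType}.

Lemma near_bounded (V : normedModType R) (f : R -> V) (t0 : R) :
  {for t0, continuous f} -> \forall t \near t0, `|f t| <= `|f t0| + 1.
Proof. by move=> /cvgr_norm_le; apply; rewrite ltrDl. Qed.

(* [T], [D] and [G] stand for theta, its partial derivatives and the Christoffel
   symbols along a geodesic with velocity [y]; the cubic identity is the Poisson
   condition.  The covector [a] is found by solving the geodesic Hamilton equation
   of 1/2 theta(a, a) covariantly along the given curve, after which [y - a T]
   satisfies a homogeneous linear equation. *)
Lemma geodesic_ode n (T : R -> 'M[R]_n) (D G : R -> 'I_n -> 'I_n -> 'I_n -> R)
    (y : R -> 'rV[R]_n) (t0 e : R) (a0 : 'rV[R]_n) : 0 < e ->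
  (forall t, `|t - t0| < e -> (T t)^T = T t) ->
  (forall t, `|t - t0| < e -> forall l i j, D t l i j = D t l j i) ->
  (forall t, `|t - t0| < e -> forall i j,
     is_derive t 1 (fun s => T s i j) (\sum_l y t 0 l * D t l i j)) ->
  (forall t, `|t - t0| < e -> forall l i j,
     {for t, continuous (fun s => D s l i j)}) ->
  (forall t, `|t - t0| < e -> forall l i j,
     {for t, continuous (fun s => G s l i j)}) ->
  (forall t, `|t - t0| < e -> is_derive t 1 y
     (- \row_k \sum_i \sum_j G t i j k * y t 0 i * y t 0 j)) ->
  (forall t, `|t - t0| < e -> forall a,
     form3 (D t) (a *m T t) a a + 2 * form3 (G t) (a *m T t) (a *m T t) a = 0) ->
  y t0 = a0 *m T t0 ->
  exists2 d, 0 < d & exists a : R -> 'rV[R]_n,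
    forall t, `|t - t0| < d -> y t = a t *m T t.
Proof.
move=> e0 symT symD DT cD cG Dy cubic yt0.
have polar t a b : `|t - t0| < e ->
    form3 (D t) (b *m T t) a a + 2 * form3 (D t) (a *m T t) a b +
    2 * form3 (G t) (b *m T t) (a *m T t) a +
    2 * form3 (G t) (a *m T t) (b *m T t) a +
    2 * form3 (G t) (a *m T t) (a *m T t) b = 0.
  move=> te; pose C a b c := form3 (D t) (a *m T t) b c +
    2 * form3 (G t) (a *m T t) (b *m T t) c.
  have polC : C b a a + C a b a + C a a b = 0.
    apply: (@cubic_polarization R n C); last exact: cubic.
    1-6: by move=> *; rewrite /C ?mulmxDl ?mulNmx
      !(form3Dl, form3Dm, form3Dr, form3Nl, form3Nm, form3Nr); ring.
  (* By [symD] the two placements of [b] among the covector slots of [D] agree, whence a factor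
     2. *)
  move: polC; rewrite /C (form3_symr (a *m T t) b a (symD t te)); lra.
have cT t : `|t - t0| < e -> forall i j, {for t, continuous (fun s => T s i j)}.
  move=> te i j; apply: differentiable_continuous; apply/derivable1_diffP.
  by apply: (@ex_derive _ _ _ _ _ _ _ (DT _ te i j)).
(* These coefficients make the pairing of [a'] with [b *m T] equal to half of the terms of [polar]
   in which [b] enters through [b *m T]. The factor [1] gives the Christoffel part the shape of
   [form3_lin]. *)
pose q t l i k := 2^-1 * D t l i k + \sum_j (1 * G t l j k + G t j l k) * T t i j.
have [|d1 d10 [a [at0 Da]]] := @quadratic_ode R n q t0 e a0 e0.
  move=> t l i j te; apply: cvgD.
    by apply: cvgM; [exact: cvg_cst|exact: cD].
  apply: sum_continuous => k; apply: cvgM; last exact: cT.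
  apply: cvgD; last exact: cG.
  by apply: cvgM; [exact: cvg_cst|exact: cG].
pose a' t : 'rV[R]_n := \row_l \sum_i \sum_j q t l i j * a t 0 i * a t 0 j.
pose y' t : 'rV[R]_n := - \row_k \sum_i \sum_j G t i j k * y t 0 i * y t 0 j.
pose T' t : 'M[R]_n := \matrix_(i, j) \sum_l y t 0 l * D t l i j.
pose u t := y t - a t *m T t.
pose du t := y' t - (a' t *m T t + a t *m T' t).
have Du t : `|t - t0| < Num.min d1 e -> is_derive t 1 u (du t).
  rewrite lt_min => /andP[td1 te]; apply/is_derive_rV => k.
  have -> : (fun s => u s 0 k) = (fun s => y s 0 k - \sum_i a s 0 i * T s i k).
    by apply/funext => s; rewrite /u !mxE.
  have -> : du t 0 k = y' t 0 k - \sum_i (a t 0 i * T' t i k + T t i k * a' t 0 i).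
    rewrite /du [LHS]mxE [X in _ + X]mxE; congr (_ - _).
    rewrite [LHS]mxE [X in X + _]mxE [X in _ + X]mxE -big_split.
    by apply: eq_bigr => i _ /=; rewrite addrC [a' t 0 i * _]mulrC.
  apply: is_deriveB; first by have /is_derive_rV := Dy t te; exact.
  rewrite -[X in is_derive _ _ X _]fct_sumE; apply: is_derive_sum => i.
  apply: is_deriveM; first by have /is_derive_rV := Da t td1; exact.
  by rewrite mxE; exact: DT.
(* [polar] trades the term with [a'] for values of [D] and [G] at [a *m T]. Combined with the values
   at [y], they leave terms that each have [u] in one slot. *)
have dotdu t b : `|t - t0| < e -> dot (du t) b =
    - (form3 (D t) (u t) (a t) b + form3 (G t) (u t) (y t) b
       + form3 (G t) (a t *m T t) (u t) b).
  move=> te; rewrite dotDl !dotNl dotDl dot_mulmx ?symT//.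
  rewrite /y' /a' dot_form3r dot_form3l.
  have -> : dot (a t *m T' t) b = form3 (D t) (y t) (a t) b.
    rewrite /dot /form3 exchange_big /=; under eq_bigr do rewrite mxE mulr_suml.
    rewrite exchange_big; apply: eq_bigr => i _; rewrite exchange_big.
    apply: eq_bigr => j _ /=; rewrite mxE mulr_sumr mulr_suml.
    by apply: eq_bigr => k _; ring.
  rewrite /q form3_lin form3_mulmxm form3_lin (form3_swap (G t) (b *m T t)).
  have := polar t (a t) b te.
  rewrite /u !(form3Dl, form3Dm, form3Nl, form3Nm).
  lra.
pose SD t := \sum_i \sum_j \sum_k `|D t i j k|.
pose SG t := \sum_i \sum_j \sum_k `|G t i j k|.
have t0e : `|t0 - t0| < e by rewrite subrr normr0.
have t0d : `|t0 - t0| < d1 by rewrite subrr normr0.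
have csum (f : R -> 'I_n -> 'I_n -> 'I_n -> R) :
    (forall i j k, {for t0, continuous (fun s => f s i j k)}) ->
    {for t0, continuous (fun s => \sum_i \sum_j \sum_k `|f s i j k|)}.
  move=> cf; do 3 apply: sum_continuous => ?; apply: cvg_norm; exact: cf.
have cderiv (f : R -> 'rV[R]_n) df : is_derive t0 1 f df -> {for t0, continuous f}.
  move=> fdf; apply: differentiable_continuous; apply/derivable1_diffP.
  exact: ex_derive.
have cu := cderiv _ _ (Du t0 ltac:(by rewrite subrr normr0 lt_min d10)).
have cy := cderiv _ _ (Dy t0 t0e).
have ca := cderiv _ _ (Da t0 t0d).
have [d2 d20 bnd] : exists2 d, 0 < d & forall t, `|t - t0| < d ->
    [/\ `|SD t| <= `|SD t0| + 1, `|SG t| <= `|SG t0| + 1,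
        `|a t| <= `|a t0| + 1, `|y t| <= `|y t0| + 1 & `|u t| <= `|u t0| + 1].
  apply: near_radius.
  have h1 : \forall t \near t0, `|SD t| <= `|SD t0| + 1.
    by apply: near_bounded; apply: csum => i j k; exact: cD.
  have h2 : \forall t \near t0, `|SG t| <= `|SG t0| + 1.
    by apply: near_bounded; apply: csum => i j k; exact: cG.
  have h3 := near_bounded ca; have h4 := near_bounded cy.
  have h5 := near_bounded cu.
  by near=> t; split; near: t.
(* These bound the three terms of [dotdu] relative to the norm of [u], near [t0] and for a test
   vector of norm at most 1; [KH] estimates [a *m T] as [y - u]. *)
pose KD := (`|SD t0| + 1) * (`|a t0| + 1).
pose KG := (`|SG t0| + 1) * (`|y t0| + 1).
pose KH := (`|SG t0| + 1) * (`|y t0| + 1 + (`|u t0| + 1)).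
have [|||||d3 d30 u0] := @linear_ode_unique R n u du t0
  (Num.min (Num.min d1 e) d2) (KD + KG + KH).
- by rewrite !lt_min d10 e0.
- by rewrite /KD /KG /KH !addr_ge0 ?mulr_ge0 ?addr_ge0.
- by rewrite /u yt0 at0 subrr.
- by move=> t; rewrite lt_min => /andP[td _]; exact: Du.
- move=> t; rewrite !lt_min => /andP[/andP[td1 te] td2].
  have [bD bG ba by' bu] := bnd t td2.
  apply/rV_norm_leP => [|k].
    by rewrite mulr_ge0// /KD /KG /KH !addr_ge0 ?mulr_ge0 ?addr_ge0.
  rewrite -dot_delta dotdu// normrN.
  have bw : `|a t *m T t| <= `|y t0| + 1 + (`|u t0| + 1).
    have -> : a t *m T t = y t - u t by rewrite /u opprB addrC subrK.
    by apply: le_trans (ler_normB _ _) _; exact: lerD.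
  have bb := @norm_delta_le1 R n k.
  have SD0 : 0 <= SD t by do 3 apply: sumr_ge0 => ? _.
  have SG0 : 0 <= SG t by do 3 apply: sumr_ge0 => ? _.
  rewrite (ger0_norm SD0) in bD; rewrite (ger0_norm SG0) in bG.
  apply: le_trans (ler_normD _ _) _; rewrite !mulrDl; apply: lerD.
    apply: le_trans (ler_normD _ _) _; apply: lerD.
  + apply: le_trans (form3_le _ _ _ _) _; rewrite -/(SD t).
    rewrite -[leRHS]mulr1; apply: ler_pM => //; first by rewrite !mulr_ge0.
    by rewrite mulrAC ler_wpM2r// ler_pM.
  + apply: le_trans (form3_le _ _ _ _) _; rewrite -/(SG t).
    rewrite -[leRHS]mulr1; apply: ler_pM => //; first by rewrite !mulr_ge0.
    by rewrite mulrAC ler_wpM2r// ler_pM.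
  + apply: le_trans (form3_le _ _ _ _) _; rewrite -/(SG t).
    rewrite -[leRHS]mulr1; apply: ler_pM => //; first by rewrite !mulr_ge0.
    by rewrite ler_wpM2r// ler_pM.
exists d3 => //; exists a => t td; apply/eqP; rewrite -subr_eq0; apply/eqP.
exact: u0.
Unshelve. all: by end_near. Qed.

End geodesic_ode.

(** * Calculus of C^k maps *)

Section Ck.
Context {R : realType} {V : normedModType R}.

Lemma Ck_onW (W : normedModType R) k (U : set V) (f : V -> W) :
  Ck_on k.+1 U f -> Ck_on k U f.
Proof.
elim: k f => [|k ih] f [df Df] /=.
  by move=> x Ux; apply: differentiable_continuous; exact: df.
by split=> // v; exact/ih/Df.
Qed.

Lemma Ck_on_sub (W : normedModType R) k (U U' : set V) (f : V -> W) :
  U' `<=` U -> Ck_on k U f -> Ck_on k U' f.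
Proof.
move=> U'U; elim: k f => [|k ih] f /=; first by move=> cf x /U'U; exact: cf.
by move=> [df Df]; split=> [x /U'U|v]; [exact: df|exact/ih/Df].
Qed.

(** Continuity and derivatives in [Ck_on] are taken in the ambient space at points of [U], so they
    may be checked point by point. *)
Lemma Ck_on_local (W : normedModType R) k (U : set V) (f : V -> W) :
  (forall x, U x -> exists2 U', U' x & Ck_on k U' f) -> Ck_on k U f.
Proof.
elim: k f => [|k ih] f /= loc.
  by move=> x /loc[U' U'x]; exact.
split=> [x /loc[U' U'x [df _]]|v]; first exact: df.
by apply: ih => x /loc[U' U'x [_ Df]]; exists U'.
Qed.

(** [g - f] vanishes near [x], so the zero map meets the little-o condition that characterizes its
    differential. *)
Lemma near_eq_differentiable (W : normedModType R) (f g : V -> W) x :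
  (\forall y \near x, f y = g y) -> differentiable f x -> differentiable g x.
Proof.
move=> fg df; rewrite -(subrK f g); apply: differentiableD => //.
have h0 : (g - f) \o shift x = cst ((g - f) x) + (\0 : V -> W) +o_ 0 id.
  apply/eqaddoP => e e0.
  have : \forall y \near 0, f (y + x) = g (y + x).
    by move: fg; rewrite (near_shift 0 x) subr0.
  apply: filterS => y fgy.
  rewrite /= !fctE (nbhs_singleton fg) -fgy !subrr addr0 subrr normr0.
  by rewrite mulr_ge0// ltW.
have c0 : continuous (\0 : V -> W) by move=> y; exact: cvg_cst.
by apply/diff_locallyP; rewrite (diff_unique c0 h0); split.
Qed.

Lemma Ck_on_eq (W : normedModType R) k (U : set V) (f g : V -> W) : open U ->
  (forall x, U x -> f x = g x) -> Ck_on k U f -> Ck_on k U g.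
Proof.
move=> oU; elim: k f g => [|k ih] f g fg.
  move=> cf x Ux; have fgx : \forall y \near x, f y = g y.
    by apply: filterS (open_nbhs_nbhs (conj oU Ux)) => y; exact: fg.
  rewrite /prop_for /continuous_at -(fg _ Ux); apply: cvg_trans (cf x Ux).
  exact: near_eq_cvg.
move=> [df Df]; split=> [x Ux|v].
  apply: near_eq_differentiable (df x Ux).
  by apply: filterS (open_nbhs_nbhs (conj oU Ux)) => y; exact: fg.
apply: ih (Df v) => x Ux; apply: near_eq_derive.
by apply: filterS (open_nbhs_nbhs (conj oU Ux)) => y; exact: fg.
Qed.

Lemma Ck_on_cst (W : normedModType R) k (U : set V) (c : W) :
  Ck_on k U (fun=> c).
Proof.
elim: k c => [|k ih] c /=; first by move=> x _; exact: cvg_cst.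
split=> [x _|v]; first exact: differentiable_cst.
have -> : (fun x => 'D_v (fun=> c) x) = (fun=> 0) :> (V -> W).
  by apply/funext => x; exact: derive_cst.
exact: ih.
Qed.

Lemma Ck_onD (W : normedModType R) k (U : set V) (f g : V -> W) : open U ->
  Ck_on k U f -> Ck_on k U g -> Ck_on k U (fun x => f x + g x).
Proof.
move=> oU; elim: k f g => [|k ih] f g /=.
  by move=> cf cg x Ux; apply: cvgD; [exact: cf|exact: cg].
move=> [df Df] [dg Dg]; split=> [x Ux|v].
  by apply: differentiableD; [exact: df|exact: dg].
apply: Ck_on_eq (ih _ _ (Df v) (Dg v)) => // x Ux.
by rewrite deriveD//; apply: diff_derivable; [exact: df|exact: dg].
Qed.

Lemma Ck_on_sum (W : normedModType R) k (U : set V) (I : Type) (r : seq I)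
  (f : I -> V -> W) : open U -> (forall i, Ck_on k U (f i)) ->
  Ck_on k U (fun x => \sum_(i <- r) f i x).
Proof.
move=> oU Cf; elim: r => [|i r ih].
  under eq_fun do rewrite big_nil; exact: Ck_on_cst.
by under eq_fun do rewrite big_cons; exact: Ck_onD.
Qed.

Lemma Ck_onM k (U : set V) (f g : V -> R) : open U ->
  Ck_on k U f -> Ck_on k U g -> Ck_on k U (fun x => f x * g x).
Proof.
move=> oU; elim: k f g => [|k ih] f g.
  by move=> cf cg x Ux; apply: cvgM; [exact: cf|exact: cg].
move=> Cf Cg; have [df Df] := Cf; have [dg Dg] := Cg; split=> [x Ux|v].
  by apply: differentiableM; [exact: df|exact: dg].
apply: Ck_on_eq (Ck_onD oU (ih _ _ (Ck_onW Cf) (Dg v))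
  (ih _ _ (Ck_onW Cg) (Df v))) => // x Ux.
by rewrite deriveM//; apply: diff_derivable; [exact: df|exact: dg].
Qed.

Lemma differentiable_rV_coord n (f : V -> 'rV[R]_n) x i :
  differentiable f x -> differentiable (fun y => f y 0 i) x.
Proof.
move=> df; apply: (@differentiable_comp _ _ _ _ f (fun M : 'rV[R]_n => M 0 i)) => //.
exact: differentiable_coord.
Qed.

Lemma derive_rV n (f : V -> 'rV[R]_n) x v i :
  differentiable f x -> ('D_v f x) 0 i = 'D_v (fun y => f y 0 i) x.
Proof. by move=> df; rewrite derive_mx ?mxE//; exact: diff_derivable. Qed.

Lemma Ck_on_coord n k (U : set V) (f : V -> 'rV[R]_n) i : open U ->
  Ck_on k U f -> Ck_on k U (fun x => f x 0 i).
Proof.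
move=> oU; elim: k f => [|k ih] f.
  move=> cf x Ux; apply: (@continuous_comp _ _ _ f (fun M : 'rV[R]_n => M 0 i)).
    exact: cf.
  exact: coord_continuous.
move=> [df Df]; split=> [x Ux|v]; first exact/differentiable_rV_coord/df.
by apply: Ck_on_eq (ih _ (Df v)) => // x Ux; rewrite derive_rV//; exact: df.
Qed.

Lemma Ck_onZl (W : normedModType R) k (U : set V) (g : V -> R) (c : W) :
  open U -> Ck_on k U g -> Ck_on k U (fun x => g x *: c).
Proof.
move=> oU; elim: k g => [|k ih] g /=.
  by move=> cg x Ux; apply: cvgZr_tmp; exact: cg.
move=> [dg Dg]; split=> [x Ux|v]; first exact/differentiableZl/dg.
apply: Ck_on_eq (ih _ (Dg v)) => // x Ux.
have dgx := dg x Ux; have dgcx := differentiableZl c dgx.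
by rewrite !deriveE// diffZl.
Qed.

Lemma Ck_on_rV n k (U : set V) (f : V -> 'rV[R]_n) : open U ->
  (forall i, Ck_on k U (fun x => f x 0 i)) -> Ck_on k U f.
Proof.
move=> oU Cf.
apply: (@Ck_on_eq _ _ _ (fun x => \sum_i f x 0 i *: delta_mx 0 i)) => //.
  by move=> x _; exact/esym/row_sum_delta.
by apply: Ck_on_sum => // i; exact: Ck_onZl.
Qed.

End Ck.

Section Ck_comp.
Context {R : realType}.

Lemma derive_row n (W : normedModType R) (g : 'rV[R]_n -> W) y w :
  differentiable g y ->
  'D_w g y = \sum_i w 0 i *: 'D_(delta_mx 0 i) g y.
Proof.
move=> dg; rewrite deriveE// [w in LHS]row_sum_delta linear_sum.
by apply: eq_bigr => i _; rewrite linearZ /= deriveE.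
Qed.

Lemma derive_real (W : normedModType R) (g : R -> W) y w :
  differentiable g y -> 'D_w g y = w *: 'D_1 g y.
Proof. by move=> dg; rewrite !deriveE// -linearZ/= [w *: 1]mulr1. Qed.

Lemma derive_comp (U V W : normedModType R) (f : U -> V) (g : V -> W) x v :
  differentiable f x -> differentiable g (f x) ->
  'D_v (fun y => g (f y)) x = 'D_('D_v f x) g (f x).
Proof.
move=> df dg; rewrite deriveE; last exact: (differentiable_comp df dg).
by rewrite diff_comp// deriveE// deriveE.
Qed.

(** In coordinates the chain rule writes the derivative as a sum of products of scalar functions,
    where one factor is again a composite with [f]; hence the induction closes on scalar [g]. *)
Lemma Ck_on_comp (V : normedModType R) n k (U : set V) (U' : set 'rV[R]_n)
    (f : V -> 'rV[R]_n) (g : 'rV[R]_n -> R) : open U -> open U' ->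
  (forall x, U x -> U' (f x)) -> Ck_on k U f -> Ck_on k U' g ->
  Ck_on k U (fun x => g (f x)).
Proof.
move=> oU oU' fU; elim: k f g fU => [|k ih] f g fU.
  move=> cf cg x Ux; apply: (@continuous_comp _ _ _ f g); first exact: cf.
  exact/cg/fU.
move=> Cf Cg; have [df Df] := Cf; have [dg Dg] := Cg; split=> [x Ux|v].
  apply: (@differentiable_comp _ _ _ _ f g); first exact: df.
  exact/dg/fU.
apply: (@Ck_on_eq _ _ _ _ _
  (fun x => \sum_i 'D_v f x 0 i * 'D_(delta_mx 0 i) g (f x))) => //.
  move=> x Ux; rewrite (derive_comp _ (df x Ux) (dg _ (fU x Ux))).
  by rewrite derive_row//; exact/dg/fU.
apply: Ck_on_sum => // i; apply: Ck_onM => //.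
  by apply: Ck_on_coord => //; exact: Df.
exact: (ih f (fun y => 'D_(delta_mx 0 i) g y) fU (Ck_onW Cf) (Dg _)).
Qed.

Lemma Ck_on_comp1 (V : normedModType R) k (U : set V) (f : V -> R) (g : R -> R) :
  open U -> Ck_on k U f -> Ck_on k setT g -> Ck_on k U (fun x => g (f x)).
Proof.
move=> oU; elim: k f g => [|k ih] f g.
  by move=> cf cg x Ux; apply: (@continuous_comp _ _ _ f g); [exact: cf|exact: cg].
move=> Cf Cg; have [df Df] := Cf; have [dg Dg] := Cg; split=> [x Ux|v].
  by apply: (@differentiable_comp _ _ _ _ f g); [exact: df|exact: dg].
apply: (@Ck_on_eq _ _ _ _ _ (fun x => 'D_v f x * 'D_1 g (f x))) => //.
  move=> x Ux; rewrite (derive_comp _ (df x Ux) (dg (f x) I)).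
  by rewrite [RHS](derive_real _ (dg (f x) I)).
apply: Ck_onM => //; first exact: Df.
exact: (ih f (fun y => 'D_1 g y) (Ck_onW Cf) (Dg _)).
Qed.

Lemma Ck_on_id (V : normedModType R) k (U : set V) : Ck_on k U (@id V).
Proof.
case: k => [|k]; first by move=> x _; exact: cvg_id.
split=> [x _|v]; first exact: ex_diff.
have -> : (fun x => 'D_v id x) = fun=> v by apply/funext => x; exact: derive_id.
exact: Ck_on_cst.
Qed.

End Ck_comp.

(** * Bump functions on coordinate space *)

Section bump.
Context {R : realType}.

(* With [p = 1] this is the flat function [exp (- 1 / t)] extended by 0; the
   family is closed under differentiation. *)
Definition flat (p : {poly R}) (t : R) : R :=
  if 0 < t then p.[t^-1] * expR (- t^-1) else 0.

(** With [N = size p], the polynomial factor is at most [A / t ^+ N] for [0 < t <= 1], and one term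
    of the exponential series bounds [expR (- t^-1)] by [(N + 2)! * t ^+ (N + 2)]. The power 2 left
    over makes the difference quotient at 0 tend to 0. *)
Lemma flat_quadratic p : exists2 C, 0 <= C &
  forall t, `|t| <= 1 -> `|flat p t| <= C * t ^+ 2.
Proof.
pose A := \sum_(i < size p) `|p`_i|; pose N := size p.
have A0 : 0 <= A by apply: sumr_ge0.
exists (A * N.+2`!%:R) => [|t t1]; first by rewrite mulr_ge0.
rewrite /flat; case: ifPn => [t0|_]; last first.
  by rewrite normr0; apply: mulr_ge0; [exact: mulr_ge0|exact: sqr_ge0].
rewrite (ger0_norm (ltW t0)) in t1.
have s1 : 1 <= t^-1 by rewrite invf_ge1.
have s0 : 0 <= t^-1 by rewrite invr_ge0 ltW.
have ps : `|p.[t^-1]| <= A * t^-1 ^+ N.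
  rewrite horner_coef mulr_suml; apply: le_trans (ler_norm_sum _ _ _) _.
  apply: ler_sum => i _; rewrite normrM ler_wpM2l// normrX (ger0_norm s0).
  by apply: ler_weXn2l => //; exact/ltnW.
rewrite normrM (ger0_norm (expR_ge0 _)) expRN.
have es : t^-1 ^+ N.+2 / N.+2`!%:R <= expR t^-1.
  by apply: le_trans (expR_ge1Dxn N.+1 s0); rewrite lerDr.
rewrite ler_pdivrMr ?expR_gt0//; apply: le_trans ps _.
apply: (@le_trans _ _ (A * N.+2`!%:R * t ^+ 2 * (t^-1 ^+ N.+2 / N.+2`!%:R))).
  rewrite -addn2 exprD le_eqVlt; apply/orP; left; apply/eqP.
  have tn : t != 0 by rewrite gt_eqF.
  have fn : (N + 2)`!%:R != 0 :> R by rewrite pnatr_eq0 -lt0n fact_gt0.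
  move: (t^-1 ^+ N) => z; field.
  by rewrite fn tn.
by rewrite ler_wpM2l//; apply: mulr_ge0; [exact: mulr_ge0|exact: sqr_ge0].
Qed.

(** Put [s = t^-1], so that [s' = - s ^+ 2]: the derivative of [p.[s] * expR (- s)] is [s ^+ 2 *
    (p.[s] - p'.[s]) * expR (- s)]. At 0 the quadratic bound takes over. *)
Lemma is_derive_flat p (t : R) :
  is_derive t 1 (flat p) (flat ('X^2 * (p - p^`())) t).
Proof.
have [t0|t0|->] := ltrgtP t 0.
- rewrite {2}/flat ltNge (ltW t0)/=.
  apply: (@near_eq_is_derive _ _ _ (cst 0)).
  near=> s; rewrite /flat ltNge ltW//.
  near: s; exact: lt_nbhsl.
- rewrite {2}/flat t0/=.
  apply: (@near_eq_is_derive _ _ _ (fun s : R => p.[s^-1] * expR (- s^-1))).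
    by near=> s; rewrite /flat ifT//; near: s; exact: lt_nbhsr.
  have tn : t != 0 by rewrite gt_eqF.
  have dV : is_derive t 1 (fun s : R => s^-1) (- t ^- 2).
    by have := is_deriveV tn (is_derive_id t 1); rewrite /GRing.scale/= mulr1.
  have dp : is_derive t 1 (horner p \o (fun s : R => s^-1)) (p^`().[t^-1] * - t ^- 2).
    have dh : is_derive t^-1 1 (horner p) (p^`().[t^-1]).
      by apply: DeriveDef; [exact: derivable_horner|rewrite -derive1E -derivE].
    exact: is_derive1_comp.
  have de : is_derive t 1 (expR \o (fun s : R => - s^-1)) (expR (- t^-1) * t ^- 2).
    have dN : is_derive t 1 (fun s : R => - s^-1) (t ^- 2).
      by rewrite -[t ^- 2]opprK; exact: is_deriveN.
    exact: is_derive1_comp.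
  have := is_deriveM dp de.
  rewrite /= /GRing.scale/= !(hornerM, hornerXn, hornerD, hornerN, hornerX) => h.
  apply: (is_derive_eq h); field.
  by rewrite tn.
- rewrite {2}/flat ltxx.
  have [C C0 CP] := flat_quadratic p.
  suff : (fun h => h^-1 *: (flat p (h *: 1 + 0) - flat p 0)) @ 0^' --> (0 : R).
    move=> h; apply: DeriveDef; first by apply/cvg_ex; exists 0.
    exact/cvg_lim.
  apply/cvgrPdist_le => /= e e0; near=> h.
  rewrite sub0r normrN addr0 [h *: 1]mulr1 {2}/flat ltxx subr0 normrM.
  have h0 : h != 0 by near: h; exact: nbhs_dnbhs_neq.
  have h1 : `|h| <= 1 by near: h; exact: dnbhs0_le.
  rewrite normfV ler_pdivrMl ?normr_gt0//; apply: le_trans (CP _ h1) _.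
  rewrite -[h ^+ 2]ger0_norm ?sqr_ge0// normrX expr2 mulrA mulrC ler_wpM2l//.
  have : `|h| <= e / (C + 1) by near: h; apply: dnbhs0_le; rewrite divr_gt0//; lra.
  rewrite ler_pdivlMr; last lra.
  by move=> he; have := normr_ge0 h; nra.
Unshelve. all: by end_near. Qed.

Lemma Ck_on_flat k U p : Ck_on k U (flat p).
Proof.
suff : Ck_on k setT (flat p) by exact: Ck_on_sub.
elim: k p => [|k ih] p.
  move=> t _; apply: differentiable_continuous; apply/derivable1_diffP.
  exact: (@ex_derive _ _ _ _ _ _ _ (is_derive_flat p t)).
have dp t : differentiable (flat p) t.
  by apply/derivable1_diffP; exact: (@ex_derive _ _ _ _ _ _ _ (is_derive_flat p t)).
split=> // v.
apply: (@Ck_on_eq _ _ _ _ _ (fun t => v * flat ('X^2 * (p - p^`())) t)).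
- exact: openT.
- by move=> t _; rewrite [RHS](derive_real _ (dp t)) (@derive_val _ _ _ _ _ _ _ (is_derive_flat p t)).
- by apply: Ck_onM; [exact: openT|exact: Ck_on_cst|exact: ih].
Qed.

(** The flat function is composed with [r ^+ 2] minus the squared Euclidean distance, which is a
    polynomial. The norm is the supremum of the coordinates, so outside radius [r] a single squared
    coordinate already exceeds [r ^+ 2]. *)
Lemma exists_bump n (q : 'rV[R]_n) (r : R) : 0 < r ->
  exists b : 'rV[R]_n -> R,
    [/\ smooth_on setT b, b q = 1 & forall x, r < `|x - q| -> b x = 0].
Proof.
move=> r0; pose s (x : 'rV[R]_n) := r ^+ 2 + - \sum_i (x 0 i - q 0 i) * (x 0 i - q 0 i) : R.
have sq : s q = r ^+ 2.
  by rewrite /s big1 ?subr0// => i _; rewrite subrr mulr0.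
have r20 : 0 < r ^+ 2 by rewrite exprn_gt0.
have fr : flat 1 (s q) != 0.
  by rewrite sq /flat r20 hornerE mul1r gt_eqF// expR_gt0.
exists (fun x => flat 1 (s x) * (flat 1 (s q))^-1); split.
- move=> k; apply: Ck_onM; [exact: openT| |exact: Ck_on_cst].
  apply: Ck_on_comp1; [exact: openT| |exact: Ck_on_flat].
  have cX i : Ck_on k setT (fun x : 'rV[R]_n => x 0 i - q 0 i).
    apply: Ck_onD; [exact: openT| |exact: Ck_on_cst].
    by apply: Ck_on_coord; [exact: openT|exact: Ck_on_id].
  rewrite /s; apply: Ck_onD; [exact: openT|exact: Ck_on_cst|].
  apply: (@Ck_on_eq _ _ _ _ _ (fun x : 'rV[R]_n => \sum_i (x 0 i - q 0 i) * (-1 * (x 0 i - q 0 i)))).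
  + exact: openT.
  + by move=> x _; rewrite -sumrN; apply: eq_bigr => i _; ring.
  + apply: Ck_on_sum; first exact: openT.
    move=> i; apply: Ck_onM; [exact: openT|exact: cX|].
    by apply: Ck_onM; [exact: openT|exact: Ck_on_cst|exact: cX].
- by rewrite divff.
- move=> x rx; rewrite {1}/flat ifF ?mul0r//; apply/negbTE; rewrite -leNgt /s subr_le0.
  have [i ri] : exists i, r < `|x 0 i - q 0 i|.
    apply/not_existsP => h; move: rx; rewrite ltNge => /negP; apply.
    apply/rV_norm_leP => [|i]; first exact: ltW.
    by rewrite !mxE leNgt; apply/negP.
  rewrite (bigD1 i)//= -expr2 -(real_normK (num_real (x 0 i - q 0 i))).
  apply: (@le_trans _ _ (`|x 0 i - q 0 i| ^+ 2)).
    by apply: lerXn2r; rewrite ?nnegrE ?(ltW r0) ?(ltW ri) ?normr_ge0.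
  by rewrite lerDl sumr_ge0// => j _; rewrite -expr2 sqr_ge0.
Qed.

End bump.

(** * Symmetric products and the symmetric Schouten bracket *)

Section symprod.
Context {R : realType} {n : nat} {M : manifold R n}.
Implicit Types (X Y Z : multifield M) (m : M) (s : seq 'cV[R]_n).

Lemma size_perm_seq s (sigma : 'S_(size s)) : size (perm_seq sigma) = size s.
Proof. by rewrite size_map size_enum_ord. Qed.

Lemma perm_seq_perm_eq s (sigma : 'S_(size s)) : perm_eq (perm_seq sigma) s.
Proof.
have sE : [seq nth 0 s (val i) | i <- enum 'I_(size s)] = s.
  by rewrite map_comp val_enum_ord map_nth_iota0// take_size.
rewrite -[X in perm_eq _ X]sE /perm_seq.
rewrite (_ : [seq nth 0 s (sigma i) | i <- enum 'I_(size s)] =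
  [seq nth 0 s (val i) | i <- [seq sigma i | i <- enum 'I_(size s)]]); last first.
  by rewrite -[RHS]map_comp; exact: eq_map.
apply: perm_map; apply: uniq_perm.
- by rewrite map_inj_uniq ?enum_uniq//; exact: perm_inj.
- exact: enum_uniq.
- move=> i; rewrite mem_enum; apply/mapP; exists (sigma^-1%g i).
    by rewrite mem_enum.
  by rewrite permKV.
Qed.

Lemma of_vf_size (X : M -> 'rV[R]_n) m s : size s != 1%N -> of_vf X m s = 0.
Proof. by case: s => [|a [|b s]]. Qed.

Lemma of_fun_size (f : M -> R) m s : size s != 0%N -> of_fun f m s = 0.
Proof. by case: s. Qed.

Lemma sum_perm_cst k (c : R) : (k`!%:R)^-1 * (\sum_(sigma : 'S_k) c) = c.
Proof.
by rewrite sumr_const card_Sn -[c *+ _]mulr_natl mulKf//.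
Qed.

(** On equal arguments all permutations agree and the average disappears. The bracket is evaluated
    on such arguments, which is all that a cubic identity asks for. *)
Lemma symprod_nseq X Y m k (a : 'cV[R]_n) :
  symprod X Y m (nseq k a) =
  \sum_(p < k.+1) 'C(k, p)%:R * (X m (nseq p a) * Y m (nseq (k - p) a)).
Proof.
rewrite /symprod.
transitivity (\sum_(p < (size (nseq k a)).+1) 'C(size (nseq k a), p)%:R *
    (X m (nseq p a) * Y m (nseq (size (nseq k a) - p) a))); last first.
  by rewrite size_nseq.
apply: eq_bigr => p _; congr (_ * _).
rewrite -[RHS](sum_perm_cst (size (nseq k a))); congr (_ * _).
apply: eq_bigr => sigma _.
have -> : perm_seq sigma = nseq (size (nseq k a)) a.
  rewrite -[in RHS](size_perm_seq sigma).
  apply/all_pred1P; apply/allP => x.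
  by rewrite (perm_mem (perm_seq_perm_eq sigma)) mem_nseq => /andP[_].
have pk : (p <= size (nseq k a))%N by rewrite -ltnS.
by rewrite take_nseq// drop_nseq.
Qed.

Lemma symprod_of_fun f Z m s : (forall s', perm_eq s' s -> Z m s' = Z m s) ->
  symprod (of_fun f) Z m s = f m * Z m s.
Proof.
move=> Zs; rewrite /symprod big_ord_recl [X in _ + X]big1 ?addr0 => [|i _].
  rewrite /= bin0 mul1r -[RHS](sum_perm_cst (size s)); congr (_ * _).
  apply: eq_bigr => sigma _; rewrite take0 drop0/= Zs//.
  exact: perm_seq_perm_eq.
rewrite big1 ?mulr0// => sigma _; rewrite of_fun_size ?mul0r//.
by rewrite size_take size_perm_seq; case: ifP => //; case: (size s) (i) => // -[].
Qed.

Lemma symprod_eq0r Y Z m s : (forall l, Z m l = 0) -> symprod Y Z m s = 0.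
Proof.
move=> Z0; rewrite /symprod big1// => p _; rewrite big1 ?mulr0// => sigma _.
by rewrite Z0 mulr0.
Qed.

Definition vf2 (X Y : M -> 'rV[R]_n) : multifield M := fun m s =>
  if s is [:: a; b] then
    pairing a (X m) * pairing b (Y m) + pairing b (X m) * pairing a (Y m)
  else 0.

Lemma sum_S2 (F : 'I_2 -> 'I_2 -> R) :
  \sum_(sigma : 'S_2) F (sigma ord0) (sigma ord_max) = F ord0 ord_max + F ord_max ord0.
Proof.
have ord2 (i : 'I_2) : i = ord0 \/ i = ord_max.
  by case: i => [[|[|//]]] i; [left|right]; apply/val_inj.
pose t : 'S_2 := tperm ord0 ord_max.
have t1 : t != 1%g.
  by apply/eqP => /(congr1 (fun s : 'S_2 => s ord0)); rewrite perm1 tpermL.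
rewrite (bigD1 1%g)//= (bigD1 t)//= !perm1 tpermL tpermR big1 ?addr0//.
move=> s /andP[s1 st]; exfalso.
have ne : s ord0 != s ord_max by rewrite (inj_eq perm_inj).
case: (ord2 (s ord0)) => s0; case: (ord2 (s ord_max)) => sm.
- by rewrite s0 sm eqxx in ne.
- move/eqP: s1; apply; apply/permP => i; rewrite perm1.
  by case: (ord2 i) => ->.
- move/eqP: st; apply; apply/permP => i.
  by case: (ord2 i) => ->; rewrite ?tpermL ?tpermR.
- by rewrite s0 sm eqxx in ne.
Qed.

Lemma symprod_vf (X Y : M -> 'rV[R]_n) :
  symprod (of_vf X) (of_vf Y) = vf2 X Y.
Proof.
apply/funext => m; apply/funext => s.
have [s2|s2] := eqVneq (size s) 2%N; last first.
  have -> : vf2 X Y m s = 0 by case: s s2 => [|a [|b [|]]].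
  rewrite /symprod big1// => p _; rewrite big1 ?mulr0// => sigma _.
  have pk : (p <= size s)%N by rewrite -ltnS.
  have [p1|p1] := eqVneq (p : nat) 1%N.
    rewrite [X in _ * X]of_vf_size ?mulr0// size_drop size_perm_seq p1 subn1.
    by apply: contra s2 => /eqP; case: (size s) => //= k ->.
  by rewrite of_vf_size ?mul0r// size_takel ?size_perm_seq.
case: s s2 => [|a [|b [|]]]// _.
rewrite /symprod !big_ord_recl big_ord0 addr0 /=.
rewrite [X in X + _](_ : _ = 0) ?add0r; last first.
  rewrite big1 ?mulr0// => sigma _; rewrite take0 mul0r//.
rewrite [X in _ + X](_ : _ = 0) ?addr0; last first.
  rewrite big1 ?mulr0// => sigma _; rewrite [X in _ * X]of_vf_size ?mulr0//.
  by rewrite size_drop size_perm_seq.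
(* Only bidegree (1, 1) is left; its binomial coefficient 2 cancels the 2! of the average. *)
rewrite /bump/= bin1.
rewrite (eq_bigr (fun sigma : 'S_2 => (fun i j : 'I_2 => pairing (nth 0 [:: a; b] i) (X m) *
   pairing (nth 0 [:: a; b] j) (Y m)) (sigma ord0) (sigma ord_max))); last first.
  move=> sigma _; rewrite /perm_seq.
  have ordE : lift ord0 ord0 = ord_max :> 'I_2 by exact/val_inj.
  by rewrite enum_ordSl enum_ordSl enum_ord0/= ordE.
rewrite (sum_S2 (fun i j : 'I_2 => pairing (nth 0 [:: a; b] i) (X m) *
   pairing (nth 0 [:: a; b] j) (Y m)))/= mulrA mulfV ?mul1r//.
Qed.

End symprod.

Section sym_multivector.
Context {R : realType} {n : nat} {M : manifold R n}.
Implicit Types (X Y Z : multifield M) (m : M) (s : seq 'cV[R]_n).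

Lemma pairing_linear (c : R) (a b : 'cV[R]_n) v :
  pairing (c *: a + b) v = c * pairing a v + pairing b v.
Proof. by rewrite /pairing mulmxDr -scalemxAr !mxE. Qed.

Lemma pairing_add (a : 'cV[R]_n) v w : pairing a (v + w) = pairing a v + pairing a w.
Proof. by rewrite /pairing mulmxDl mxE. Qed.

Lemma sym_zero : is_sym_multivector (fun (_ : M) (_ : seq 'cV[R]_n) => 0 : R).
Proof.
split => // [m a al be s||c s cA k]; first by rewrite mulr0 addr0.
  by exists 0%N.
exact: Ck_on_cst.
Qed.

Lemma sym_lin (a : R) X Y : is_sym_multivector X -> is_sym_multivector Y ->
  is_sym_multivector (fun m s => a * X m s + Y m s).
Proof.
move=> [X1 X2 [NX X3] X4] [Y1 Y2 [NY Y3] Y4]; split.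
- by move=> m s s' ss'; rewrite (X1 m s s')// (Y1 m s s').
- by move=> m b al be s; rewrite X2 Y2; ring.
- exists (NX + NY)%N => m s ls; rewrite X3 ?Y3 ?mulr0 ?addr0//.
    by apply: leq_ltn_trans ls; exact: leq_addl.
  by apply: leq_ltn_trans ls; exact: leq_addr.
- move=> c s cA k; apply: Ck_onD; [exact: target_open| |exact: Y4].
  by apply: Ck_onM; [exact: target_open|exact: Ck_on_cst|exact: X4].
Qed.

Lemma sym_sum (I : Type) (r : seq I) (X : I -> multifield M) :
  (forall i, is_sym_multivector (X i)) ->
  is_sym_multivector (fun m s => \sum_(i <- r) X i m s).
Proof.
move=> Xs; elim: r => [|i r ih].
  rewrite (_ : (fun m s => _) = (fun _ _ => 0)); first exact: sym_zero.
  by apply/funext => m; apply/funext => s; rewrite big_nil.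
rewrite (_ : (fun m s => _) =
  (fun m s => 1 * X i m s + (fun m s => \sum_(i <- r) X i m s) m s)).
  exact: sym_lin.
by apply/funext => m; apply/funext => s; rewrite big_cons mul1r.
Qed.

Lemma sym_of_fun f :
  (forall c, atlas c -> smooth_on (target c) (fun x => f (of_coord c x))) ->
  is_sym_multivector (@of_fun R n M f).
Proof.
move=> fs; split.
- by move=> m [|a s] [|b s']// /perm_size.
- by move=> m a al be s /=; rewrite mulr0 addr0.
- by exists 0%N => m [].
- by move=> c [|w s] cA k /=; [exact: fs|exact: Ck_on_cst].
Qed.

Lemma smooth_pairing (X : M -> 'rV[R]_n) c w k : smooth_vf_on setT X -> atlas c ->
  Ck_on k (target c)
    (fun x => pairing (covector_of_coord c (of_coord c x) w) (X (of_coord c x))).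
Proof.
move=> Xs cA; have := Xs c cA; rewrite preimage_setT setIT => {}Xs.
apply: (@Ck_on_eq _ _ _ _ _ (fun x =>
    \sum_i tangent_coord c (of_coord c x) (X (of_coord c x)) 0 i * w i 0)).
- exact: target_open.
- by move=> x _; rewrite /pairing /covector_of_coord mulmxA [RHS]mxE.
- apply: Ck_on_sum => [|i]; first exact: target_open.
  apply: Ck_onM; [exact: target_open| |exact: Ck_on_cst].
  by apply: Ck_on_coord; [exact: target_open|exact: Xs].
Qed.

Lemma sym_of_vf (X : M -> 'rV[R]_n) : smooth_vf_on setT X ->
  is_sym_multivector (of_vf X).
Proof.
move=> Xs; split.
- move=> m [|a [|a' s]] [|b [|b' s']]//; try by move/perm_size.
  by rewrite perm_sym => /perm_small_eq => /(_ isT)[->].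
- by move=> m a al be [|b s] /=; rewrite ?pairing_linear ?mulr0 ?addr0.
- by exists 1%N => m [|a []].
- move=> c [|w [|w' s]] cA k /=; try exact: Ck_on_cst.
  exact: smooth_pairing.
Qed.

Lemma sym_vf2 (X Y : M -> 'rV[R]_n) : smooth_vf_on setT X -> smooth_vf_on setT Y ->
  is_sym_multivector (vf2 X Y).
Proof.
move=> Xs Ys; split.
- move=> m s s' ss'; have := perm_size ss'.
  case: s s' ss' => [|a [|b [|c s]]] [|a' [|b' [|c' s']]]// ss' _ /=.
  have : a \in [:: a'; b'] by rewrite -(perm_mem ss') mem_head.
  rewrite !inE => /orP[] /eqP aE; move: ss'; rewrite aE.
    by rewrite perm_cons => /perm_small_eq => /(_ isT)[->].
  rewrite -[[:: a'; b']]/([:: a'] ++ [:: b']) perm_sym perm_catC perm_cons.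
  by move=> /perm_small_eq => /(_ isT)[->]; rewrite addrC; congr (_ + _); rewrite mulrC.
- move=> m a al be [|b [|c s]] /=; rewrite ?mulr0 ?addr0//.
  by rewrite !pairing_linear; ring.
- by exists 2%N => m [|a [|b []]].
- move=> c [|w [|w' [|w'' s]]] cA k /=; try exact: Ck_on_cst.
  have oc : open (target c) by exact: target_open.
  by apply: Ck_onD => //; apply: Ck_onM => //; exact: smooth_pairing.
Qed.

Lemma sym_funM (f : M -> R) Y :
  (forall c, atlas c -> smooth_on (target c) (fun x => f (of_coord c x))) ->
  is_sym_multivector Y -> is_sym_multivector (fun m s => f m * Y m s).
Proof.
move=> fs [Y1 Y2 [N Y3] Y4]; split.
- by move=> m s s' ss'; rewrite (Y1 m s s').
- by move=> m a al be s; rewrite Y2; ring.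
- by exists N => m s ls; rewrite Y3 ?mulr0.
- move=> c s cA k; apply: Ck_onM; [exact: target_open|exact: fs|exact: Y4].
Qed.

End sym_multivector.

(** * Consequences of the bracket axioms *)

Section schouten.
Context {R : realType} {n : nat} {M : manifold R n} (nabla : connection M)
  (B : multifield M -> multifield M -> multifield M).
Context (hB : is_symmetric_schouten nabla B).
Implicit Types (X Y Z : multifield M) (m : M) (s : seq 'cV[R]_n).

Lemma schouten_is_sym X Y : is_sym_multivector X -> is_sym_multivector Y ->
  is_sym_multivector (B X Y).
Proof. by case: hB => h _; exact: h. Qed.

Lemma schoutenC X Y : is_sym_multivector X -> is_sym_multivector Y -> B X Y = B Y X.
Proof.
case: hB => _ [h _] Xs Ys; apply/funext => m; apply/funext => s; exact: h.
Qed.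

Lemma schouten_linear (a : R) X Y Z : is_sym_multivector X -> is_sym_multivector Y ->
  is_sym_multivector Z -> forall m s,
  B (fun p l => a * X p l + Y p l) Z m s = a * B X Z m s + B Y Z m s.
Proof. by case: hB => _ [_ [h _]]; exact: h. Qed.

Lemma schouten_vf (X Y : M -> 'rV[R]_n) : smooth_vf_on setT X -> smooth_vf_on setT Y ->
  B (of_vf X) (of_vf Y) = of_vf (fun m => nabla m (X m) Y + nabla m (Y m) X).
Proof.
case: hB => _ [_ [_ [h _]]] Xs Ys; apply/funext => m; apply/funext => s; exact: h.
Qed.

Lemma schouten_derivation r X Y Z : is_sym_multivector X -> homogeneous r X ->
  is_sym_multivector Y -> is_sym_multivector Z -> forall m l,
  B X (symprod Y Z) m l = symprod (B X Y) Z m l + symprod Y (B X Z) m l.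
Proof. by case: hB => _ [_ [_ [_ [_ [_ h]]]]]; exact: h. Qed.

Lemma schouten_zero Z m s : is_sym_multivector Z ->
  B (fun _ _ => 0) Z m s = 0.
Proof.
move=> Zs; have := schouten_linear (-1) sym_zero sym_zero Zs m s.
move=> h; rewrite -[RHS](addNr (B (fun _ _ => 0) Z m s)) -mulN1r -h.
by congr (B _ Z m s); apply/funext => p; apply/funext => l; rewrite mulr0 addr0.
Qed.

Lemma schouten_sum (I : Type) (r : seq I) (X : I -> multifield M) Z m s :
  (forall i, is_sym_multivector (X i)) -> is_sym_multivector Z ->
  B (fun m s => \sum_(i <- r) X i m s) Z m s = \sum_(i <- r) B (X i) Z m s.
Proof.
move=> Xs Zs; elim: r => [|i r ih].
  rewrite [RHS]big_nil -[RHS](schouten_zero m s Zs); congr (B _ Z m s).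
  by apply/funext => p; apply/funext => l; rewrite big_nil.
rewrite big_cons -ih -[X in X + _]mul1r -schouten_linear//; last exact: sym_sum.
congr (B _ Z m s).
by apply/funext => p; apply/funext => l; rewrite big_cons mul1r.
Qed.

(* A derivation kills, at [q], products with two factors vanishing at [q]. *)
Lemma schouten_local r X Y (h1 h2 : M -> R) (q : M) l :
  is_sym_multivector X -> homogeneous r X -> is_sym_multivector Y ->
  (forall c, atlas c -> smooth_on (target c) (fun x => h1 (of_coord c x))) ->
  (forall c, atlas c -> smooth_on (target c) (fun x => h2 (of_coord c x))) ->
  h1 q = 0 -> h2 q = 0 ->
  B X (fun m s => h1 m * (h2 m * Y m s)) q l = 0.
Proof.
move=> Xs Xr Ys h1s h2s h10 h20.
have h2Ys := sym_funM h2s Ys; have h1f := sym_of_fun h1s.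
have -> : (fun m s => h1 m * (h2 m * Y m s)) =
    symprod (of_fun h1) (fun m s => h2 m * Y m s).
  apply/funext => m; apply/funext => s; rewrite symprod_of_fun// => s' ss'.
  by case: h2Ys => h _ _ _; exact: h.
rewrite (schouten_derivation Xs Xr h1f h2Ys) symprod_eq0r ?add0r; last first.
  by move=> s; rewrite h20 mul0r.
rewrite symprod_of_fun ?h10 ?mul0r// => s' ss'.
by case: (schouten_is_sym Xs h2Ys) => h _ _ _; exact: h.
Qed.

(** Applying the derivation rule in each argument in turn leaves brackets of vector fields. The
    factor 6 comes from the equal arguments: ['C(3, 1) = 'C(3, 2) = 3] for the outer product,
    ['C(2, 1) = 2] for the inner one. *)
Lemma schouten_vf2 (W E : 'I_n -> M -> 'rV[R]_n) (q : M) (a : 'cV[R]_n) :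
  (forall j, smooth_vf_on setT (W j)) -> (forall j, smooth_vf_on setT (E j)) ->
  let theta m s := \sum_j vf2 (W j) (E j) m s in
  let br (X Y : M -> 'rV[R]_n) := pairing a (nabla q (X q) Y + nabla q (Y q) X) in
  let w j := pairing a (W j q) in let e j := pairing a (E j q) in
  B theta theta q (nseq 3 a) = 6 * \sum_j \sum_k
    (br (W j) (W k) * e k * e j + w k * br (W j) (E k) * e j +
     w j * (br (E j) (W k) * e k) + w j * (w k * br (E j) (E k))).
Proof.
move=> Ws Es theta br w e.
have vs j := sym_vf2 (Ws j) (Es j).
have ts : is_sym_multivector theta by exact: sym_sum.
have t2 : homogeneous 2 theta.
  move=> m s s2; rewrite /theta big1// => j _.
  by case: s s2 => [|? [|? [|]]].
have v1 (X : M -> 'rV[R]_n) : homogeneous 1 (@of_vf R n M X) by move=> m s; exact: of_vf_size.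
have B2 (X : M -> 'rV[R]_n) : smooth_vf_on setT X -> B theta (of_vf X) q (nseq 2 a) =
    2 * \sum_k (br X (W k) * e k + w k * br X (E k)).
  move=> Xs; have xs := sym_of_vf Xs; rewrite schouten_sum// mulr_sumr.
  apply: eq_bigr => k _; rewrite schoutenC// -symprod_vf.
  rewrite (schouten_derivation xs (@v1 X) (sym_of_vf (Ws k)) (sym_of_vf (Es k))) !schouten_vf//.
  rewrite !symprod_nseq !big_ord_recl !big_ord0 /= /bump/= /e /w /br.
  by rewrite !(bin0, bin1, binn) ?(mul0r, mulr0, addr0, add0r); ring.
rewrite [in LHS]/theta schouten_sum// mulr_sumr; apply: eq_bigr => j _.
rewrite schoutenC// -symprod_vf.
rewrite (schouten_derivation ts t2 (sym_of_vf (Ws j)) (sym_of_vf (Es j))).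
rewrite !symprod_nseq !big_ord_recl !big_ord0 /= /bump/=.
rewrite !(mul0r, mulr0, addr0, add0r).
have /= -> := B2 _ (Ws j); have /= -> := B2 _ (Es j).
have -> : 'C(3, 1 + (1 + 0)) = 3%N by [].
have -> : 'C(3, 1 + 0) = 3%N by [].
have -> : \sum_k (br (W j) (W k) * e k * e j + w k * br (W j) (E k) * e j +
      w j * (br (E j) (W k) * e k) + w j * (w k * br (E j) (E k))) =
    (\sum_k (br (W j) (W k) * e k + w k * br (W j) (E k))) * e j +
    w j * \sum_k (br (E j) (W k) * e k + w k * br (E j) (E k)).
  by rewrite mulr_suml mulr_sumr -big_split; apply: eq_bigr => k _ /=; ring.
rewrite -/(e j) -/(w j); ring.
Qed.

End schouten.

(** * Charts, smooth extension and connections *)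

Section charts.
Context {R : realType} {n : nat} {M : manifold R n}.
Implicit Types (c : chart R n M) (m : M).

(** This is the set on which [smooth_fun_on] and [smooth_vf_on] ask for smoothness in the chart
    [c]. *)
Definition chart_dom c (S : set M) : set 'rV[R]_n :=
  target c `&` of_coord c @^-1` S.

Lemma chart_dom_open c S : open S -> open (chart_dom c S).
Proof.
move=> oS; rewrite openE => x [tx Sx].
have oT : open (target c) by exact: target_open.
apply: filterI; first exact: open_nbhs_nbhs.
have cx := of_coord_continuous tx.
by apply: cx; exact: open_nbhs_nbhs.
Qed.

Lemma chart_dom_coord c S m : source c m -> S m -> chart_dom c S (c m).
Proof.
by move=> cm Sm; split; [exact: to_coord_target|rewrite /preimage/= to_coordK].
Qed.

Lemma near_chart_dom c S m : open S -> source c m -> S m ->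
  \forall x \near c m, chart_dom c S x.
Proof.
move=> oS cm Sm; apply: open_nbhs_nbhs; split; first exact: chart_dom_open.
exact: chart_dom_coord.
Qed.

Lemma transition_smooth c c' : atlas c -> atlas c' ->
  smooth_on (chart_dom c (source c')) (fun x => c' (of_coord c x)).
Proof. exact: atlas_compatible. Qed.

Lemma transition_differentiable c c' m : atlas c -> atlas c' ->
  source c m -> source c' m ->
  differentiable (fun x => c' (of_coord c x)) (c m).
Proof.
move=> cA c'A cm c'm; have [h _] := transition_smooth cA c'A 1%N.
by apply: h; exact: chart_dom_coord.
Qed.

Lemma dchartE c m v : atlas c -> source c m ->
  v *m dchart c m = 'D_v (fun x => c (of_coord (chart_at m) x)) (chart_at m m).
Proof.
move=> cA cm; rewrite deriveEjacobian//.
apply: transition_differentiable => //; first exact: chart_at_atlas.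
exact: chart_at_source.
Qed.

(** Near [chart_at m m], [f] read in the preferred chart is [f] read in [c] after the transition
    map, whose differential is [dchart c m]. *)
Lemma derive_through_chart (W : normedModType R) c m (f : M -> W) v :
  atlas c -> source c m -> differentiable (fun x => f (of_coord c x)) (c m) ->
  'D_v (fun x => f (of_coord (chart_at m) x)) (chart_at m m)
  = 'D_(v *m dchart c m) (fun x => f (of_coord c x)) (c m).
Proof.
move=> cA cm df; have sm := @chart_at_source _ _ M m.
have mA := @chart_at_atlas _ _ M m.
have om : of_coord (chart_at m) (chart_at m m) = m by rewrite to_coordK.
rewrite dchartE//.
rewrite -[in X in _ = 'D__ _ (c X)]om.
rewrite -(@derive_comp _ _ _ _ (fun x => c (of_coord (chart_at m) x))
  (fun x => f (of_coord c x))) ?om//; last exact: transition_differentiable.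
apply: near_eq_derive.
have oc : open (source c) by exact: source_open.
apply: filterS (near_chart_dom oc sm cm) => x [tx cx].
by rewrite to_coordK.
Qed.

Lemma dchart_comp c c' m : atlas c -> atlas c' -> source c m -> source c' m ->
  dchart c' m = dchart c m *m jacobian (fun x => c' (of_coord c x)) (c m).
Proof.
move=> cA c'A cm c'm; apply/row_matrixP => i; rewrite !rowE mulmxA.
have dt := transition_differentiable cA c'A cm c'm.
apply: etrans (dchartE _ c'A c'm) _.
apply: etrans (@derive_through_chart _ c m (fun p => to_coord c' p) _ cA cm dt) _.
exact: deriveEjacobian.
Qed.

Lemma dchart_chart_at m : dchart (chart_at m) m = 1%:M.
Proof.
have sm := @chart_at_source _ _ M m; have mA := @chart_at_atlas _ _ M m.
apply/row_matrixP => i; rewrite !rowE mulmx1 dchartE//.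
rewrite -[RHS](derive_id (chart_at m m)).
apply: near_eq_derive.
have oc : open [set: M] by exact: openT.
by apply: filterS (near_chart_dom oc sm I) => x [tx _]; rewrite of_coordK.
Qed.

End charts.

(* Otherwise unification unfolds [dchart] when comparing it to other Jacobians. *)
#[local] Opaque dchart.

Section chart_smoothness.
Context {R : realType} {n : nat} {M : manifold R n}.
Implicit Types (c : chart R n M) (m : M).

(** The cocycle rule with the preferred chart as second chart exhibits an inverse, since [dchart] of
    the preferred chart is the identity. *)
Lemma dchart_unit c m : atlas c -> source c m -> dchart c m \in unitmx.
Proof.
move=> cA cm; have sm := @chart_at_source _ _ M m.
have h := dchart_comp cA (@chart_at_atlas _ _ M m) cm sm.
by have [h1 _] := mulmx1_unit (etrans (esym h) (dchart_chart_at m)); exact: h1.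
Qed.

Lemma tangent_coord_field c c' i m : atlas c -> atlas c' ->
  source c m -> source c' m ->
  tangent_coord c' m (coord_field c i m)
  = 'D_(delta_mx 0 i) (fun x => c' (of_coord c x)) (c m).
Proof.
move=> cA c'A cm c'm; rewrite /tangent_coord /coord_field.
rewrite (dchart_comp cA c'A cm c'm) mulmxA mulmxKV ?dchart_unit//.
by rewrite deriveEjacobian//; exact: transition_differentiable.
Qed.

(** In a chart [c'], the components are the [i]-th partial derivatives of the transition map from
    [c] to [c'], composed with the transition map back. *)
Lemma smooth_coord_field c i : atlas c ->
  smooth_vf_on (source c) (coord_field c i).
Proof.
move=> cA c' c'A k.
have o1 : open (chart_dom c' (source c)) by apply/chart_dom_open/source_open.
have o2 : open (chart_dom c (source c')) by apply/chart_dom_open/source_open.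
apply: (@Ck_on_eq _ _ _ _ _
    (fun x => 'D_(delta_mx 0 i) (fun y => c' (of_coord c y)) (c (of_coord c' x)))) => //.
  move=> x [tx cx]; rewrite tangent_coord_field//; exact: of_coord_source.
apply: Ck_on_rV => // j.
apply: (@Ck_on_comp _ _ _ _ _ (chart_dom c (source c')) (fun x => c (of_coord c' x))
   (fun y => 'D_(delta_mx 0 i) (fun y => c' (of_coord c y)) y 0 j)) => //.
- by move=> x [tx cx]; apply: chart_dom_coord => //; exact: of_coord_source.
- exact: transition_smooth.
- apply: Ck_on_coord => //.
  by have [_] := transition_smooth cA c'A k.+1; apply.
Qed.

Lemma smooth_fun_chart c (f : M -> R) : atlas c ->
  smooth_on (target c) (fun x => f (of_coord c x)) -> smooth_fun_on (source c) f.
Proof.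
move=> cA fs c' c'A k.
have o1 : open (chart_dom c' (source c)) by apply/chart_dom_open/source_open.
apply: (@Ck_on_eq _ _ _ _ _ (fun x => f (of_coord c (c (of_coord c' x))))) => //.
  by move=> x [tx cx]; rewrite to_coordK.
apply: (@Ck_on_comp _ _ _ _ _ (target c) (fun x => c (of_coord c' x))
   (fun y => f (of_coord c y))) => //.
- exact: target_open.
- by move=> x [tx cx]; exact: to_coord_target.
- exact: transition_smooth.
Qed.

(** [U] and the complement of [K] form an open cover: on the first [F] is smooth by assumption, on
    the second it vanishes. *)
Lemma smooth_ext0 (W : normedModType R) c (U K : set M) (F : 'rV[R]_n -> W) :
  open U -> closed K -> K `<=` U -> smooth_on (chart_dom c U) F ->
  (forall x, target c x -> ~ K (of_coord c x) -> F x = 0) ->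
  smooth_on (chart_dom c setT) F.
Proof.
move=> oU cK KU Fs F0 k; apply: Ck_on_local => x [tx _].
have [Ux|nUx] := pselect (U (of_coord c x)).
  by exists (chart_dom c U) => //; exact: Fs.
exists (chart_dom c (~` K)); first by split=> // /KU.
apply: (@Ck_on_eq _ _ _ _ _ (fun=> 0)); last exact: Ck_on_cst.
  by apply: chart_dom_open; exact: closed_openC.
by move=> y [ty Ky]; rewrite F0.
Qed.

Lemma smooth_fun_ext0 (U K : set M) (f : M -> R) :
  open U -> closed K -> K `<=` U -> smooth_fun_on U f ->
  (forall m, ~ K m -> f m = 0) -> smooth_fun_on setT f.
Proof.
move=> oU cK KU fs f0 c cA; apply: (smooth_ext0 oU cK KU (fs c cA)) => x _.
exact: f0.
Qed.

Lemma smooth_vf_ext0 (U K : set M) (X : M -> 'rV[R]_n) :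
  open U -> closed K -> K `<=` U -> smooth_vf_on U X ->
  (forall m, ~ K m -> X m = 0) -> smooth_vf_on setT X.
Proof.
move=> oU cK KU Xs X0 c cA; apply: (smooth_ext0 oU cK KU (Xs c cA)) => x _ Kx.
by rewrite X0// /tangent_coord mul0mx.
Qed.

Lemma smooth_funM (U : set M) (f g : M -> R) : open U ->
  smooth_fun_on U f -> smooth_fun_on U g -> smooth_fun_on U (fun m => f m * g m).
Proof.
move=> oU fs gs c cA k.
by apply: Ck_onM; [exact: chart_dom_open|exact: fs|exact: gs].
Qed.

Lemma smooth_funD (U : set M) (f g : M -> R) : open U ->
  smooth_fun_on U f -> smooth_fun_on U g -> smooth_fun_on U (fun m => f m + g m).
Proof.
move=> oU fs gs c cA k.
by apply: Ck_onD; [exact: chart_dom_open|exact: fs|exact: gs].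
Qed.

Lemma smooth_fun_cst (U : set M) (a : R) : smooth_fun_on U (fun=> a).
Proof. by move=> c cA k; exact: Ck_on_cst. Qed.

Lemma smooth_vfM (U : set M) (f : M -> R) (X : M -> 'rV[R]_n) : open U ->
  smooth_fun_on U f -> smooth_vf_on U X -> smooth_vf_on U (fun m => f m *: X m).
Proof.
move=> oU fs Xs c cA k; have oV : open (chart_dom c U) by exact: chart_dom_open.
apply: Ck_on_rV => // i.
apply: (@Ck_on_eq _ _ _ _ _ (fun x => f (of_coord c x) *
    tangent_coord c (of_coord c x) (X (of_coord c x)) 0 i)) => //.
  by move=> x _; rewrite /tangent_coord -scalemxAl [RHS]mxE.
by apply: Ck_onM => //; [exact: fs|apply: Ck_on_coord => //; exact: Xs].
Qed.

Lemma smooth_vf_sum (U : set M) (I : Type) (r : seq I) (X : I -> M -> 'rV[R]_n) :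
  open U -> (forall i, smooth_vf_on U (X i)) ->
  smooth_vf_on U (fun m => \sum_(i <- r) X i m).
Proof.
move=> oU Xs c cA k; have oV : open (chart_dom c U) by exact: chart_dom_open.
apply: (@Ck_on_eq _ _ _ _ _ (fun x => \sum_(i <- r)
    tangent_coord c (of_coord c x) (X i (of_coord c x)))) => //.
  by move=> x _; rewrite /tangent_coord mulmx_suml.
by apply: Ck_on_sum => // i; exact: Xs.
Qed.

Lemma smooth_fun_differentiable c (U : set M) (f : M -> R) m : atlas c -> open U ->
  smooth_fun_on U f -> source c m -> U m ->
  differentiable (fun x => f (of_coord c x)) (c m).
Proof.
by move=> cA oU fs cm Um; have [h _] := fs c cA 1%N; apply: h; exact: chart_dom_coord.
Qed.

Lemma smooth_setT c (f : M -> R) : atlas c -> smooth_fun_on setT f ->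
  smooth_on (target c) (fun x => f (of_coord c x)).
Proof. by move=> cA /(_ c cA); rewrite preimage_setT setIT. Qed.

Lemma smooth_fun_sub (U V : set M) (f : M -> R) : V `<=` U ->
  smooth_fun_on U f -> smooth_fun_on V f.
Proof.
move=> VU fs c cA k; apply: Ck_on_sub (fs c cA k) => x [tx Vx]; split => //.
exact: VU.
Qed.

(** [K] is the image of a closed ball contained in [target c], hence compact, hence closed as [M] is
    Hausdorff. This makes the extension of the coordinate bump by 0 smooth. *)
Lemma exists_manifold_bump c (q : M) : atlas c -> source c q ->
  exists2 chi : M -> R, smooth_fun_on setT chi /\ chi q = 1 &
    exists K : set M, [/\ closed K, K `<=` source c & forall m, ~ K m -> chi m = 0].
Proof.
move=> cA cq.
have oc : open (source c) by exact: source_open.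
have ot : open (target c) by exact: target_open.
have [r r0 rT] : exists2 r, 0 < r & forall x, `|x - c q| <= r -> target c x.
  have : nbhs (c q) (target c) by apply: open_nbhs_nbhs; split=> //; exact: to_coord_target.
  move=> /nbhs_ballP[e /= e0 eT]; exists (e / 2); first by rewrite divr_gt0.
  move=> x xe; apply: eT; rewrite mx_norm_ball /ball_/= distrC.
  by apply: le_lt_trans xe _; lra.
have [b [bs bq b0]] := exists_bump (c q) r0.
pose A := [set x | `|x - c q| <= r].
have cptA : compact A.
  apply: bounded_closed_compact.
    exists (`|c q| + r); split; first exact: num_real.
    move=> x xr y /= yA; apply: ltW; apply: le_lt_trans xr.
    by rewrite -(subrK (c q) y) addrC; apply: le_trans (ler_normD _ _) _; rewrite lerD2l.
  rewrite (_ : A = closed_ball_ Num.norm (c q) r); first exact: closed_closed_ball_.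
  by apply/funext => x; rewrite /A/= /closed_ball_/= distrC.
pose K := of_coord c @` A.
have cK : closed K.
  apply: compact_closed; first exact: points_hausdorff.
  apply: continuous_compact => //; apply: continuous_in_subspaceT => x.
  rewrite inE => xA; apply: of_coord_continuous; exact: rT.
have Ks : K `<=` source c.
  by move=> _ [x xA <-]; apply: of_coord_source; exact: rT.
pose chi m : R := if `[< source c m >] then b (c m) else 0.
have chiE m : source c m -> chi m = b (c m) by move=> cm; rewrite /chi asboolT.
have chi0 m : ~ K m -> chi m = 0.
  move=> Km; rewrite /chi; case: asboolP => // cm; apply: b0.
  rewrite ltNge; apply/negP => mA; apply: Km; exists (c m) => //.
  exact: to_coordK.
exists chi; last by exists K.
split; last by rewrite chiE.
apply: (smooth_fun_ext0 oc cK Ks) => //.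
apply: (smooth_fun_chart cA) => k.
apply: (@Ck_on_eq _ _ _ _ _ b) => //.
  by move=> x tx; rewrite chiE ?of_coordK//; exact: of_coord_source.
by apply: Ck_on_sub (bs k).
Qed.

End chart_smoothness.

Section connection.
Context {R : realType} {n : nat} {M : manifold R n} (nabla : connection M).

Lemma smooth_vf_zero (U : set M) : smooth_vf_on U (fun _ : M => 0 : 'rV[R]_n).
Proof.
move=> c cA k; rewrite (_ : (fun x => _) = fun=> 0); first exact: Ck_on_cst.
by apply/funext => x; rewrite /tangent_coord mul0mx.
Qed.

Lemma cov_zero m v : nabla m v (fun=> 0) = 0.
Proof.
have := cov_add nabla openT (I : [set: M] m) (@smooth_vf_zero setT)
  (@smooth_vf_zero setT) v.
under eq_fun do rewrite addr0.
by move=> /(congr1 (fun x => x - nabla m v (fun=> 0))); rewrite addrK subrr.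
Qed.

Lemma cov_sumr (U : set M) (I : Type) (r : seq I) (Y : I -> M -> 'rV[R]_n) m v :
  open U -> U m -> (forall i, smooth_vf_on U (Y i)) ->
  nabla m v (fun p => \sum_(i <- r) Y i p) = \sum_(i <- r) nabla m v (Y i).
Proof.
move=> oU Um Ys; elim: r => [|i r ih].
  by rewrite big_nil -[RHS](cov_zero m v); under eq_fun do rewrite big_nil.
rewrite big_cons -ih -(cov_add nabla oU Um)//; last exact: smooth_vf_sum.
by under eq_fun do rewrite big_cons.
Qed.

Lemma cov_zerol (U : set M) (Y : M -> 'rV[R]_n) m :
  open U -> U m -> smooth_vf_on U Y -> nabla m 0 Y = 0.
Proof.
move=> oU Um Ys; have := cov_linear nabla oU Um Ys (-1) 0 0.
by rewrite scaler0 addr0 scaleN1r addNr.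
Qed.

Lemma cov_suml (U : set M) (I : Type) (r : seq I) (x : I -> R)
    (v : I -> 'rV[R]_n) (Y : M -> 'rV[R]_n) m :
  open U -> U m -> smooth_vf_on U Y ->
  nabla m (\sum_(i <- r) x i *: v i) Y = \sum_(i <- r) x i *: nabla m (v i) Y.
Proof.
move=> oU Um Ys; elim: r => [|i r ih].
  by rewrite !big_nil (cov_zerol oU Um Ys).
by rewrite !big_cons (cov_linear nabla oU Um Ys) ih.
Qed.

Lemma pairingZ (a : 'cV[R]_n) x v : pairing a (x *: v) = x * pairing a v.
Proof. by rewrite /pairing -scalemxAl mxE. Qed.

Lemma pairing_sum (I : Type) (r : seq I) (a : 'cV[R]_n) (x : I -> R) v :
  pairing a (\sum_(i <- r) x i *: v i) = \sum_(i <- r) x i * pairing a (v i).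
Proof.
rewrite /pairing mulmx_suml summxE; apply: eq_bigr => i _.
by rewrite -scalemxAl mxE.
Qed.

Lemma coord_field_chart (c : chart R n M) i m : atlas c -> source c m ->
  coord_field c i m *m dchart c m = delta_mx 0 i.
Proof. by move=> cA cm; rewrite /coord_field mulmxKV ?dchart_unit. Qed.

Lemma pairing_coord_field (c : chart R n M) i m a : atlas c -> source c m ->
  pairing (covector_of_coord c m a) (coord_field c i m) = a i 0.
Proof.
move=> cA cm; rewrite /pairing /covector_of_coord mulmxA coord_field_chart//.
by rewrite -rowE mxE.
Qed.

Lemma dirderiv_coord_field (c : chart R n M) i m (f : M -> R) (U : set M) :
  atlas c -> source c m -> open U -> U m -> smooth_fun_on U f ->
  dirderiv m (coord_field c i m) f
  = 'D_(delta_mx 0 i) (fun x => f (of_coord c x)) (c m).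
Proof.
move=> cA cm oU Um fs.
have := derive_through_chart (coord_field c i m) cA cm
  (smooth_fun_differentiable cA oU fs cm Um).
by rewrite coord_field_chart.
Qed.

Lemma dirderivM (U : set M) m v (f g : M -> R) : open U -> U m ->
  smooth_fun_on U f -> smooth_fun_on U g ->
  dirderiv m v (fun p => f p * g p)
  = f m * dirderiv m v g + g m * dirderiv m v f.
Proof.
move=> oU Um fs gs; have sm := @chart_at_source _ _ M m.
have mA := @chart_at_atlas _ _ M m.
have df := smooth_fun_differentiable mA oU fs sm Um.
have dg := smooth_fun_differentiable mA oU gs sm Um.
rewrite /dirderiv -[in f m](to_coordK sm) -[in g m](to_coordK sm).
exact: (deriveM (diff_derivable df) (diff_derivable dg)).
Qed.

Lemma dirderivD (U : set M) m v (f g : M -> R) : open U -> U m ->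
  smooth_fun_on U f -> smooth_fun_on U g ->
  dirderiv m v (fun p => f p + g p) = dirderiv m v f + dirderiv m v g.
Proof.
move=> oU Um fs gs; have sm := @chart_at_source _ _ M m.
have mA := @chart_at_atlas _ _ M m.
have df := smooth_fun_differentiable mA oU fs sm Um.
have dg := smooth_fun_differentiable mA oU gs sm Um.
exact: (deriveD (diff_derivable df) (diff_derivable dg)).
Qed.

Lemma dirderiv_cst m v (a : R) : dirderiv m v (fun _ : M => a) = 0.
Proof. exact: derive_cst. Qed.

End connection.

(** * The Poisson condition in coordinates *)

Section bivector.
Context {R : realType} {n : nat} {M : manifold R n}.

Lemma multifield_suml (X : multifield M) (I : Type) (r : seq I) m (x : I -> R)
    (v : I -> 'cV[R]_n) s : is_sym_multivector X ->
  X m ((\sum_(i <- r) x i *: v i) :: s) = \sum_(i <- r) x i * X m (v i :: s).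
Proof.
move=> [_ Xlin _ _]; elim: r => [|i r ih]; last by rewrite !big_cons Xlin ih.
rewrite !big_nil; have := Xlin m (-1) 0 0 s.
by rewrite scaler0 addr0 mulN1r addNr.
Qed.

Definition bivector_coord (X : multifield M) (c : chart R n M) (m : M) : 'M[R]_n :=
  \matrix_(i, j) X m [:: covector_of_coord c m (delta_mx i 0);
                         covector_of_coord c m (delta_mx j 0)].

Lemma bivector_coordE X c m a b : is_sym_multivector X ->
  X m [:: covector_of_coord c m a; covector_of_coord c m b]
  = \sum_i \sum_j a i 0 * b j 0 * bivector_coord X c m i j.
Proof.
move=> Xs; have [Xp _ _ _] := Xs.
have covE (d : 'cV[R]_n) : covector_of_coord c m d =
    \sum_i d i 0 *: covector_of_coord c m (delta_mx i 0).
  rewrite /covector_of_coord [d in LHS]matrix_sum_delta mulmx_sumr.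
  by apply: eq_bigr => i _; rewrite big_ord1 scalemxAr.
rewrite [covector_of_coord c m a]covE multifield_suml//; apply: eq_bigr => i _.
rewrite (Xp m _ [:: covector_of_coord c m b; covector_of_coord c m (delta_mx i 0)]); last first.
  by rewrite -[X in perm_eq X]/([:: _] ++ [:: _]) perm_catC.
rewrite [covector_of_coord c m b]covE multifield_suml// mulr_sumr.
apply: eq_bigr => j _; rewrite mxE -mulrA; congr (_ * (_ * _)); apply: Xp.
by rewrite -[X in perm_eq X]/([:: _] ++ [:: _]) perm_catC.
Qed.

Lemma bivector_coord_sym X c m : is_sym_multivector X ->
  (bivector_coord X c m)^T = bivector_coord X c m.
Proof.
move=> [Xp _ _ _]; apply/matrixP => i j; rewrite !mxE; apply: Xp.
by rewrite -[X in perm_eq X]/([:: _] ++ [:: _]) perm_catC.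
Qed.

Lemma smooth_bivector_chart X c i j : is_sym_multivector X -> atlas c ->
  smooth_on (target c) (fun x => bivector_coord X c (of_coord c x) i j).
Proof.
move=> [_ _ _ Xs] cA; under eq_fun do rewrite mxE.
exact: (Xs c [:: delta_mx i 0; delta_mx j 0] cA).
Qed.

Lemma smooth_bivector X c i j : is_sym_multivector X -> atlas c ->
  smooth_fun_on (source c) (fun m => bivector_coord X c m i j).
Proof.
by move=> Xs cA; apply: smooth_fun_chart => //; exact: smooth_bivector_chart.
Qed.

End bivector.

(** * The cubic identity *)

Section cubic.
Context {R : realType} {n : nat}.

(** Index bookkeeping for [W_j = 1/2 T^{lj} d_l] and [E_j = d_j], with [P l k] and [Q l k] the
    pairings of [a] with the derivatives along [d_l] of [d_k] and [W_k]. Each of the eight products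
    in the summand adds up to [QQ] or [PP], four times each. *)
Lemma cubic_sum (T P Q : 'I_n -> 'I_n -> R) (a : 'I_n -> R) :
  (forall i j, T i j = T j i) ->
  let w k := \sum_l 2^-1 * T l k * a l in
  \sum_j \sum_k
    ((\sum_l 2^-1 * T l j * Q l k + \sum_l 2^-1 * T l k * Q l j) * a k * a j
     + w k * (\sum_l 2^-1 * T l j * P l k + Q k j) * a j
     + w j * ((Q j k + \sum_l 2^-1 * T l k * P l j) * a k)
     + w j * (w k * (P j k + P k j)))
  = 4 * (\sum_l \sum_k w l * Q l k * a k + \sum_l \sum_k w l * w k * P l k).
Proof.
move=> TC w.
have wE (F : 'I_n -> R) : \sum_j (\sum_l 2^-1 * T l j * F l) * a j = \sum_l w l * F l.
  under eq_bigr do rewrite mulr_suml.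
  rewrite exchange_big; apply: eq_bigr => l _ /=; rewrite /w mulr_suml.
  by apply: eq_bigr => j _; rewrite (TC l j); ring.
pose QQ := \sum_l \sum_k w l * Q l k * a k.
pose PP := \sum_l \sum_k w l * w k * P l k.
have A1 : \sum_j \sum_k (\sum_l 2^-1 * T l j * Q l k) * a k * a j = QQ.
  rewrite exchange_big /QQ [RHS]exchange_big; apply: eq_bigr => k _ /=.
  under eq_bigr do rewrite mulrAC.
  by rewrite -mulr_suml wE mulr_suml.
have A2 : \sum_j \sum_k (\sum_l 2^-1 * T l k * Q l j) * a k * a j = QQ.
  by rewrite -A1 exchange_big; apply: eq_bigr => j _; apply: eq_bigr => k _ /=; ring.
have B1 : \sum_j \sum_k w k * (\sum_l 2^-1 * T l j * P l k) * a j = PP.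
  rewrite exchange_big /PP [RHS]exchange_big; apply: eq_bigr => k _ /=.
  under eq_bigr do rewrite -mulrA.
  by rewrite -mulr_sumr wE mulr_sumr; apply: eq_bigr => l _; ring.
have B2 : \sum_j \sum_k w k * Q k j * a j = QQ by rewrite exchange_big.
have C2 : \sum_j \sum_k w j * (\sum_l 2^-1 * T l k * P l j) * a k = PP.
  by rewrite -B1 exchange_big.
have D2 : \sum_j \sum_k w j * w k * P k j = PP.
  rewrite exchange_big; apply: eq_bigr => j _; apply: eq_bigr => k _ /=; ring.
transitivity ((QQ + QQ) + (PP + QQ) + (QQ + PP) + (PP + PP)); last by rewrite -/QQ -/PP; ring.
rewrite -{1}A1 -{1}A2 -{1}B1 -{1}B2 -{1}C2 -{2}D2 /QQ /PP -!big_split /=.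
by apply: eq_bigr => j _; rewrite -!big_split /=; apply: eq_bigr => k _; ring.
Qed.

Context {M : manifold R n}.

Lemma poisson_cubic (theta : multifield M) (nabla : connection M)
    (c : chart R n M) (q : M) (a : 'rV[R]_n) :
  symmetric_poisson theta nabla -> atlas c -> source c q ->
  let T := bivector_coord theta c q in
  let D l i j := 'D_(delta_mx 0 l)
    (fun x => bivector_coord theta c (of_coord c x) i j) (c q) in
  let G i j k := christoffel nabla c q i j 0 k in
  form3 D (a *m T) a a + 2 * form3 G (a *m T) (a *m T) a = 0.
Proof.
move=> [thetas theta2 _ [B hB Btt]] cA cq T D G.
have [chi [chis chiq] [K [cK Ks chi0]]] := exists_manifold_bump cA cq.
have oT : open [set: M] by exact: openT.
have oc : open (source c) by exact: source_open.
(* [psi = 1 - h1 ^ 2] has vanishing derivative at [q], and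
   [psi ^ 2 = 1 - h1 * h2]: multiplying theta by [psi ^ 2] does not affect its
   bracket at [q] and turns it into a sum of products of global vector fields. *)
pose h1 m := 1 + -1 * chi m.
pose h2 m := h1 m * (2 + -1 * (h1 m * h1 m)).
pose psi m := chi m * (2 + -1 * chi m).
have cst (x : R) : smooth_fun_on setT (fun _ : M => x) by exact: smooth_fun_cst.
have h1s : smooth_fun_on setT h1.
  by apply: smooth_funD => //; exact: smooth_funM.
have h2s : smooth_fun_on setT h2.
  apply: smooth_funM => //; apply: smooth_funD => //; apply: smooth_funM => //.
  exact: smooth_funM.
have psi2s : smooth_fun_on setT (fun m => 2 + -1 * chi m).
  by apply: smooth_funD => //; exact: smooth_funM.
have psis : smooth_fun_on setT psi by exact: smooth_funM.
have psiq : psi q = 1 by rewrite /psi chiq; ring.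
have psi0 m : ~ K m -> psi m = 0 by move=> /chi0; rewrite /psi => ->; rewrite mul0r.
(* The derivative of [chi * (2 - chi)] is [2 * (1 - chi)] times that of [chi], and [chi q = 1]. *)
have dpsi v : dirderiv q v psi = 0.
  rewrite (dirderivM v oT I chis psi2s)
    (dirderivD v oT I (cst 2) (smooth_funM oT (cst (-1)) chis)).
  rewrite (dirderivM v oT I (cst (-1)) chis) !dirderiv_cst chiq; ring.
have psisc : smooth_fun_on (source c) psi by apply: smooth_fun_sub psis.
pose d := coord_field c.
have ds i : smooth_vf_on (source c) (d i) by exact: smooth_coord_field.
(* The factor 1/2 offsets the normalization of the symmetric product, which counts both orders of
   the two factors. *)
pose TT i j m := 2^-1 * bivector_coord theta c m i j.
have TTs i j : smooth_fun_on (source c) (TT i j).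
  by apply: smooth_funM => //; [exact: smooth_fun_cst|exact: smooth_bivector].
have fs i j : smooth_fun_on (source c) (fun m => psi m * TT i j m).
  exact: smooth_funM.
(* [E] and [W] carry one factor [psi] each: both extend by 0 to global fields, and their products
   give [psi ^ 2] times theta. *)
pose E j m := psi m *: d j m.
pose W j m := \sum_l (psi m * TT l j m) *: d l m.
have Es j : smooth_vf_on setT (E j).
  apply: (smooth_vf_ext0 oc cK Ks); first exact: smooth_vfM.
  by move=> m Km; rewrite /E psi0// scale0r.
have Wl l j : smooth_vf_on (source c) (fun m => (psi m * TT l j m) *: d l m).
  exact: smooth_vfM.
have Ws j : smooth_vf_on setT (W j).
  apply: (smooth_vf_ext0 oc cK Ks); first exact: smooth_vf_sum.
  by move=> m Km; rewrite /W big1// => l _; rewrite psi0// mul0r scale0r.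
pose theta' : multifield M := fun m s => -1 * (h1 m * (h2 m * theta m s)) + theta m s.
have h1c c' : atlas c' -> smooth_on (target c') (fun x => h1 (of_coord c' x)).
  by move=> ?; exact: smooth_setT.
have h2c c' : atlas c' -> smooth_on (target c') (fun x => h2 (of_coord c' x)).
  by move=> ?; exact: smooth_setT.
have h12s : is_sym_multivector (fun m s => h1 m * (h2 m * theta m s)).
  by apply: sym_funM => //; exact: sym_funM.
have theta's : is_sym_multivector theta' by exact: sym_lin.
have theta'2 : homogeneous 2 theta'.
  by move=> m s s2; rewrite /theta' theta2// !mulr0 addr0.
have h1q : h1 q = 0 by rewrite /h1 chiq; ring.
have h2q : h2 q = 0 by rewrite /h2 h1q mul0r.
have theta'E : theta' = fun m s => \sum_j vf2 (W j) (E j) m s.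
  apply/funext => m; apply/funext => s.
  have -> : theta' m s = psi m * psi m * theta m s.
    by rewrite /theta' /psi /h2 /h1; ring.
  have [s2|s2] := eqVneq (size s) 2%N; last first.
    rewrite theta2// mulr0 big1// => j _.
    by case: s s2 => [|? [|? [|]]].
  case: s s2 => [|al [|be []]]// _.
  have [cm|ncm] := pselect (source c m); last first.
    have p0 : psi m = 0 by apply: psi0 => /Ks.
    rewrite p0 !mul0r big1// => j _ /=.
    by rewrite /E p0 scale0r /pairing !mul0mx !mxE !mulr0 addr0.
  have covK b : b = covector_of_coord c m (invmx (dchart c m) *m b).
    by rewrite /covector_of_coord mulKVmx ?dchart_unit.
  rewrite (covK al) (covK be); move: (invmx _ *m al) (invmx _ *m be) => a1 b1.
  have Wp j b : pairing (covector_of_coord c m b) (W j m) =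
      psi m * \sum_l TT l j m * b l 0.
    rewrite /W pairing_sum mulr_sumr; apply: eq_bigr => l _.
    by rewrite /d pairing_coord_field// -mulrA.
  have Ep j b : pairing (covector_of_coord c m b) (E j m) = psi m * b j 0.
    by rewrite /E pairingZ /d pairing_coord_field.
  under eq_bigr do rewrite /= !Wp !Ep.
  rewrite bivector_coordE//.
  have TC i j : bivector_coord theta c m i j = bivector_coord theta c m j i.
    by rewrite -[in LHS](bivector_coord_sym c m thetas) mxE.
  transitivity (psi m * psi m * (\sum_j (\sum_l TT l j m * a1 l 0) * b1 j 0 +
      \sum_j (\sum_l TT l j m * b1 l 0) * a1 j 0)); last first.
    rewrite mulrDr !mulr_sumr -big_split; apply: eq_bigr => j _ /=; ring.
  congr (_ * _); under [X in _ = X + _]eq_bigr do rewrite mulr_suml.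
  under [X in _ = _ + X]eq_bigr do rewrite mulr_suml.
  rewrite [X in _ = X + _]exchange_big -big_split; apply: eq_bigr => i _ /=.
  rewrite -big_split; apply: eq_bigr => j _ /=.
  by rewrite /TT (TC j i); field.
(* Symmetry moves the correction [h1 * h2 * theta] into the second slot, where [schouten_local]
   removes it; this is done once for each argument. *)
have Btt' s : B theta' theta' q s = 0.
  rewrite {1}/theta' (schouten_linear hB)// (schoutenC hB)//.
  rewrite (schouten_local hB (r := 2))// mulr0 add0r (schoutenC hB)//.
  rewrite {1}/theta' (schouten_linear hB)// (schoutenC hB)//.
  by rewrite (schouten_local hB (r := 2))// Btt mulr0 addr0.
have := Btt' (nseq 3 (covector_of_coord c q a^T)).
rewrite theta'E (schouten_vf2 hB)//.
have H6 (x : R) : 6 * x = 0 -> x = 0 by lra.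
move=> /H6; set ap := covector_of_coord c q a^T => H.
have Tq l j : TT l j q = 2^-1 * T l j by [].
have Eq j : E j q = d j q by rewrite /E psiq scale1r.
have Wq j : W j q = \sum_l (2^-1 * T l j) *: d l q.
  by apply: eq_bigr => l _; rewrite psiq mul1r Tq.
have dp l : pairing ap (d l q) = a 0 l.
  by rewrite /ap /d pairing_coord_field// mxE.
pose P l k := pairing ap (nabla q (d l q) (d k)).
pose Q l k := pairing ap (nabla q (d l q) (W k)).
pose w k := \sum_l 2^-1 * T l k * a 0 l.
have eE j : pairing ap (E j q) = a 0 j by rewrite Eq dp.
have wE j : pairing ap (W j q) = w j.
  by rewrite Wq pairing_sum; apply: eq_bigr => l _; rewrite dp.
(* [psi] has value 1 and derivative 0 at [q], so cutting off leaves covariant derivatives at [q]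
   unchanged. *)
have PE l k : pairing ap (nabla q (d l q) (E k)) = P l k.
  rewrite (cov_leibniz nabla oc cq psisc (ds k)) dpsi scale0r add0r psiq.
  by rewrite scale1r.
have WX j X : smooth_vf_on setT X -> pairing ap (nabla q (W j q) X) =
    \sum_l 2^-1 * T l j * pairing ap (nabla q (d l q) X).
  by move=> Xs; rewrite Wq (cov_suml nabla _ _ _ oT I Xs) pairing_sum.
have WW j k : pairing ap (nabla q (W j q) (W k)) = \sum_l 2^-1 * T l j * Q l k.
  exact: WX.
have WE j k : pairing ap (nabla q (W j q) (E k)) = \sum_l 2^-1 * T l j * P l k.
  by rewrite WX//; apply: eq_bigr => l _; rewrite PE.
(* The Leibniz rule on [W]: here the partial derivatives of theta enter, together with a further
   Christoffel term. *)
have QE l k : Q l k = \sum_i 2^-1 * (D l i k * a 0 i + T i k * P l i).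
  rewrite /Q (cov_sumr nabla _ _ oc cq (fun i => Wl i k)).
  rewrite /pairing mulmx_suml summxE; apply: eq_bigr => i _.
  rewrite -/(pairing ap _) (cov_leibniz nabla oc cq (fs i k) (ds i)).
  rewrite pairing_add !pairingZ dp -/(P l i).
  rewrite psiq mul1r Tq (dirderivM _ oc cq psisc (TTs i k)) dpsi mulr0 addr0.
  rewrite psiq mul1r (dirderivM _ oc cq (@smooth_fun_cst _ _ _ _ _)
    (smooth_bivector i k thetas cA)).
  rewrite dirderiv_cst mulr0 addr0 /d.
  rewrite (dirderiv_coord_field _ cA cq oc cq (smooth_bivector i k thetas cA)).
  by rewrite -/(D l i k); ring.
have PG l k : P l k = \sum_m G l k m * a 0 m.
  rewrite /P /pairing /ap /covector_of_coord mulmxA mxE.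
  by apply: eq_bigr => m _; rewrite [a^T _ _]mxE.
have TC i j : T i j = T j i.
  by rewrite /T -[in LHS](bivector_coord_sym c q thetas) mxE.
have := cubic_sum P Q (fun k => a 0 k) TC; rewrite /= -/w => CS.
have {H} S0 : 4 * (\sum_l \sum_k w l * Q l k * a 0 k + \sum_l \sum_k w l * w k * P l k) = 0.
  rewrite -[RHS]H -CS; apply: eq_bigr => j _; apply: eq_bigr => k _.
  by rewrite !pairing_add !eE !wE !WW !WE !Eq !PE.
have wT l : (a *m T) 0 l = 2 * w l.
  by rewrite mxE /w mulr_sumr; apply: eq_bigr => i _; field.
have wS i : \sum_k T i k * a 0 k = 2 * w i.
  by rewrite /w mulr_sumr; apply: eq_bigr => k _; rewrite (TC i k); field.
move: (w) wT wS S0 => {CS WX WW WE eE wE Wq} {}w wT wS S0; rewrite -[RHS]S0.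
have -> : form3 G (a *m T) (a *m T) a = 4 * \sum_l \sum_k w l * w k * P l k.
  rewrite /form3 mulr_sumr; apply: eq_bigr => l _; rewrite mulr_sumr.
  apply: eq_bigr => k _; rewrite !wT PG !mulr_sumr; apply: eq_bigr => m _; ring.
rewrite [RHS]mulrDr.
(* The Christoffel term inside [Q] contributes as much as the explicit one in [P], whence the factor
   2 in the cubic identity. *)
suff -> : 4 * \sum_l \sum_k w l * Q l k * a 0 k = form3 D (a *m T) a a +
    4 * \sum_l \sum_k w l * w k * P l k by ring.
rewrite /form3 !mulr_sumr -big_split; apply: eq_bigr => l _ /=.
rewrite !mulr_sumr exchange_big.
transitivity (\sum_k \sum_i (D l i k * (a *m T) 0 l * a 0 i * a 0 k +
    2 * w l * P l i * (T i k * a 0 k))).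
  apply: eq_bigr => k _; rewrite QE wT mulr_sumr mulr_suml mulr_sumr.
  by apply: eq_bigr => i _; field.
rewrite (eq_bigr _ (fun k _ => big_split _ _ _ _ _)) big_split /=.
congr (_ + _); rewrite exchange_big; apply: eq_bigr => i _ /=.
by rewrite -mulr_sumr wS; ring.
Qed.

End cubic.

(** * Geodesics *)

Section geodesics.
Context {R : realType} {n : nat} {M : manifold R n}.

(** As [dchart c m] is invertible, every covector has components in the chart, so the image
    condition becomes membership in the row space of the component matrix. *)
Lemma characteristic_distributionP (theta : multifield M) (c : chart R n M) m v :
  is_sym_multivector theta -> atlas c -> source c m ->
  characteristic_distribution theta m v <->
  exists a : 'rV[R]_n, v *m dchart c m = a *m bivector_coord theta c m.
Proof.
move=> thetas cA cm; have du := dchart_unit cA cm.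
have covK b : b = covector_of_coord c m (invmx (dchart c m) *m b).
  by rewrite /covector_of_coord mulKVmx.
have pairE b : pairing (covector_of_coord c m b) v = ((v *m dchart c m) *m b) 0 0.
  by rewrite /pairing /covector_of_coord mulmxA.
have thetaE (a : 'rV[R]_n) b :
    theta m [:: covector_of_coord c m a^T; covector_of_coord c m b] =
    ((a *m bivector_coord theta c m) *m b) 0 0.
  rewrite bivector_coordE// mxE exchange_big; apply: eq_bigr => j _ /=.
  rewrite [X in X * _]mxE mulr_suml; apply: eq_bigr => i _.
  by rewrite [a^T _ _]mxE; ring.
split=> [[al alP]|[a aP]].
- have alE : al = covector_of_coord c m ((invmx (dchart c m) *m al)^T)^T.
    by rewrite trmxK -covK.
  exists (invmx (dchart c m) *m al)^T; apply/rowP => j.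
  have := alP (covector_of_coord c m (delta_mx j 0)).
  by rewrite pairE {1}alE thetaE -!colE !mxE.
- exists (covector_of_coord c m a^T) => be.
  by rewrite (covK be) pairE thetaE aP.
Qed.

Lemma curve_differentiable (I : set R) (gamma : R -> M) (c : chart R n M) t :
  smooth_curve I gamma -> atlas c -> I t -> source c (gamma t) ->
  differentiable (fun s => c (gamma s)) t.
Proof. by move=> [_ gs] cA It ct; have [h _] := gs c cA 1%N; exact: h. Qed.

(** Near [t] the curve read in [c] is the transition map applied to the curve read in the preferred
    chart at [gamma t], the one that [velocity] uses. *)
Lemma velocity_coord (I : set R) (gamma : R -> M) (c : chart R n M) t :
  smooth_curve I gamma -> atlas c -> I t -> source c (gamma t) ->
  velocity gamma t *m dchart c (gamma t) = derive1 (fun s => c (gamma s)) t.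
Proof.
move=> gs cA It ct; have sm := @chart_at_source _ _ M (gamma t).
have mA := @chart_at_atlas _ _ M (gamma t).
rewrite dchartE// /velocity !derive1E.
have dg := curve_differentiable gs mA It sm.
have dt := transition_differentiable mA cA sm ct.
rewrite -(@derive_comp _ _ _ _ (fun s => chart_at (gamma t) (gamma s))
  (fun x => c (of_coord (chart_at (gamma t)) x)))//.
apply: near_eq_derive; case: gs => [gc _].
have : \forall s \near t, source (chart_at (gamma t)) (gamma s).
  apply: gc => //; apply: open_nbhs_nbhs; split => //; exact: source_open.
by apply: filterS => s gst; rewrite to_coordK.
Qed.

Lemma christoffel_continuous (nabla : connection M) (c : chart R n M) i j k x :
  atlas c -> target c x ->
  {for x, continuous (fun z => christoffel nabla c (of_coord c z) i j 0 k)}.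
Proof.
move=> cA tx; have oc : open (source c) by exact: source_open.
have := cov_smooth nabla oc (smooth_coord_field i cA) (smooth_coord_field j cA).
move=> /(_ c cA 0%N) h.
apply: rV_coord_continuous; apply: h; split=> //; exact: of_coord_source.
Qed.

End geodesics.

Theorem theorem6p18 (R : realType) (n : nat) (M : manifold R n)
    (theta : multifield M) (nabla : connection M)
    (htheta : symmetric_poisson theta nabla) :
  locally_geodesically_invariant nabla (characteristic_distribution theta).
Proof.
move=> I gamma t0 oI _ [gs geo] It0.
have [thetas _ _ _] := htheta.
pose c := chart_at (gamma t0).
have cA : atlas c by exact: chart_at_atlas.
have ct0 : source c (gamma t0) by exact: chart_at_source.
move=> /(characteristic_distributionP _ thetas cA ct0)[a0].
rewrite (velocity_coord gs cA It0 ct0) => a0P.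
pose x s := c (gamma s); pose J := I `&` gamma @^-1` source c.
have xs : smooth_on J x by case: (gs) => _; exact.
(* Radius [e] keeps the curve in the domain of [c], so that everything below happens in one
   chart. *)
have [e e0 eJ] : exists2 e, 0 < e & forall t, `|t - t0| < e -> J t.
  apply: near_radius; apply: filterI; first exact: open_nbhs_nbhs.
  case: (gs) => gc _; apply: gc => //; apply: open_nbhs_nbhs; split => //.
  exact: source_open.
have oe t : `|t - t0| < e -> \forall s \near t, J s.
  by move=> te; apply: filterS (near_dist te) => s; exact: eJ.
have dx t : `|t - t0| < e -> differentiable x t.
  by move=> /eJ Jt; have [h _] := xs 1%N; exact: h.
have cx t : `|t - t0| < e -> {for t, continuous x}.
  by move=> te; apply: differentiable_continuous; exact: dx.
have tx t : `|t - t0| < e -> target c (x t).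
  by move=> /eJ[_ ct]; exact: to_coord_target.
pose f i j z := bivector_coord theta c (of_coord c z) i j.
have fs i j : smooth_on (target c) (f i j) by exact: smooth_bivector_chart.
pose T t := bivector_coord theta c (gamma t).
pose D t l i j := 'D_(delta_mx 0 l) (f i j) (x t).
pose G t i j k := christoffel nabla c (gamma t) i j 0 k.
have ofx t : `|t - t0| < e -> \forall s \near t, of_coord c (x s) = gamma s.
  by move=> te; apply: filterS (oe t te) => s [_ cs]; rewrite to_coordK.
have [||||||||d d0 [a aP]] := @geodesic_ode R n T D G (derive1 x) t0 e a0 e0.
- by move=> t te; exact: bivector_coord_sym.
- move=> t te l i j; congr ('D_ _ _ _); apply/funext => z.
  by rewrite /f -[in LHS](bivector_coord_sym c _ thetas) mxE.
- move=> t te i j.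
  have df : differentiable (f i j) (x t) by have [h _] := fs i j 1%N; apply: h; exact: tx.
  apply: (@near_eq_is_derive _ _ _ (fun s => f i j (x s))).
    by apply: filterS (ofx t te) => s; rewrite /f /T => ->.
  apply: DeriveDef.
    by apply: diff_derivable; exact: (differentiable_comp (dx t te) df).
  by rewrite (derive_comp _ (dx t te) df) derive1E derive_row.
- move=> t te l i j; apply: (@continuous_comp _ _ _ x (fun z => 'D_(delta_mx 0 l) (f i j) z)).
    exact: cx.
  have [_ h] := fs i j 1%N; apply: h; exact: tx.
- move=> t te i j k.
  (* Continuity is available in the chart, at [of_coord c (x s)]; it passes to [gamma s], which is
     known to agree with that point for [s] near [t]. *)
  have h : {for t, continuous (fun s => christoffel nabla c (of_coord c (x s)) i j 0 k)}.
    apply: (@continuous_comp _ _ _ x (fun z => christoffel nabla c (of_coord c z) i j 0 k)).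
      exact: cx.
    by apply: christoffel_continuous => //; exact: tx.
  rewrite /prop_for /continuous_at {2}/G -(nbhs_singleton (ofx t te)).
  apply: cvg_trans h; apply: near_eq_cvg.
  by apply: filterS (ofx t te) => s; rewrite /G => ->.
- move=> t te; have [It ct] := eJ t te.
  have := geo t c It cA ct; rewrite -/x => /eqP; rewrite addr_eq0 => /eqP xE.
  have -> : \row_k (\sum_i \sum_j G t i j k * derive1 x t 0 i * derive1 x t 0 j) =
     \sum_(i < n) \sum_(j < n) (derive1 x t 0 i * derive1 x t 0 j)
         *: christoffel nabla c (gamma t) i j.
    apply/rowP => k; rewrite mxE summxE; apply: eq_bigr => i _.
    rewrite summxE; apply: eq_bigr => j _; rewrite [RHS]mxE /G; ring.
  rewrite -xE derive1E; apply: derivableP.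
  have d1E : derive1 x = fun s => 'D_1 x s by apply/funext => s; rewrite derive1E.
  rewrite d1E; apply: diff_derivable; have [_ h] := xs 2%N.
  by have [h' _] := h 1; apply: h'; exact: eJ.
- move=> t te b; have [_ ct] := eJ t te.
  exact: poisson_cubic.
- exact: a0P.
(* Within [d] the covector solves [x' = a *m T]; within [e] this equation describes the image of
   theta in the chart. *)
exists `]t0 - Num.min d e, t0 + Num.min d e[%classic.
have de0 : 0 < Num.min d e by rewrite lt_min d0.
have inE t : `]t0 - Num.min d e, t0 + Num.min d e[%classic t ->
    `|t - t0| < d /\ `|t - t0| < e.
  rewrite /= in_itv/= => /andP[t1 t2]; apply/andP; rewrite -lt_min ltr_norml.
  by apply/andP; split; lra.
split.
- exact: interval_open.
- exact: interval_is_interval.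
- by move=> t /inE[_ /eJ[]].
- by rewrite /= in_itv/=; apply/andP; split; lra.
- move=> t /inE[td te]; have [It ct] := eJ t te.
  apply/(characteristic_distributionP _ thetas cA ct); exists (a t).
  by rewrite (velocity_coord gs cA It ct); exact: aP.
Qed.
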